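(* Let $P$ be a set of $n$ points in $\mathbb{R}^1$, each associated with a color, and let $\varepsilon\in(0,1)$. A deterministic data structure of size $O\!\left(\frac{n}{\varepsilon}\log^2 n\right)$ can be constructed in $O\!\left(\frac{n}{\varepsilon}\log^5 n\right)$ time such that, given a query interval $R$, a value $h$ can be computed in $O\!\left(\log^2 n\log\frac{\log n}{\varepsilon}\right)$ time satisfying $H(P\cap R)\le h\le(1+\varepsilon)H(P\cap R)+\varepsilon$.
   Context: Real-RAM model. For $P'\subseteq P$ and color $c$, $P'(c)$ is the set of points of color $c$ in $P'$ and $u(P')$ the set of colors in $P'$. Shannon entropy: $H(P')=\sum_{c\in u(P')}\frac{|P'(c)|}{|P'|}\log_2\frac{|P'|}{|P'(c)|}$. *)

(* Defs.v *)
From Stdlib Require Import Reals List ZArith Arith.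
Import ListNotations.
Open Scope R_scope.

Definition log2 (x : R) : R := ln x / ln 2.

(* A colored point of R^1: (position, color); colors are encoded as naturals. *)
Definition cpoint := (R * nat)%type.

Definition inter (P : list cpoint) (a b : R) : list cpoint :=
  filter (fun p => if Rle_dec a (fst p) then if Rle_dec (fst p) b then true else false
                   else false) P.

Definition colors (Q : list cpoint) : list nat := nodup Nat.eq_dec (map snd Q).

Definition ccount (Q : list cpoint) (c : nat) : nat :=
  length (filter (fun p => Nat.eqb (snd p) c) Q).

(* H(P') = sum_{c in u(P')} |P'(c)|/|P'| log2 (|P'|/|P'(c)|)  (= 0 if P' empty) *)
Definition entropy (Q : list cpoint) : R :=
  let N := INR (length Q) in
  fold_right Rplus 0
    (map (fun c => let k := INR (ccount Q c) in k / N * log2 (N / k)) (colors Q)).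

(* Memory: infinitely many cells, each holding a real.  Programs are lists of
   instructions; pc indexes the program.  Unit-cost operations: integer
   constants, + - * /, log2 (an analytic function, as in the Preparata–Shamos
   real-RAM), comparisons with branching, and indirect addressing through cells
   holding non-negative integers. *)
Inductive instr : Type :=
| IConst (d : nat) (z : Z)
| IAdd (d a b : nat)
| ISub (d a b : nat)
| IMul (d a b : nat)
| IDiv (d a b : nat)
| ILog2 (d a : nat)
| ILoad (d a : nat)
| IStore (a s : nat)
| IJlt (a b t : nat)
| IJeq (a b t : nat)
| IJmp (t : nat)
| IHalt.

Definition mem := nat -> R.
Definition state := (nat * mem)%type.

Definition upd (m : mem) (d : nat) (v : R) : mem :=
  fun i => if Nat.eqb i d then v else m i.

(* One (deterministic) step of program p. A machine that performs an illegal
   operation or jumps outside the program is stuck (does not halt). *)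
Inductive step (p : list instr) : state -> state -> Prop :=
| st_const pc m d z : nth_error p pc = Some (IConst d z) ->
    step p (pc, m) (S pc, upd m d (IZR z))
| st_add pc m d a b : nth_error p pc = Some (IAdd d a b) ->
    step p (pc, m) (S pc, upd m d (m a + m b))
| st_sub pc m d a b : nth_error p pc = Some (ISub d a b) ->
    step p (pc, m) (S pc, upd m d (m a - m b))
| st_mul pc m d a b : nth_error p pc = Some (IMul d a b) ->
    step p (pc, m) (S pc, upd m d (m a * m b))
| st_div pc m d a b : nth_error p pc = Some (IDiv d a b) -> m b <> 0 ->
    step p (pc, m) (S pc, upd m d (m a / m b))
| st_log2 pc m d a : nth_error p pc = Some (ILog2 d a) -> 0 < m a ->
    step p (pc, m) (S pc, upd m d (log2 (m a)))
| st_load pc m d a k : nth_error p pc = Some (ILoad d a) -> m a = INR k ->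
    step p (pc, m) (S pc, upd m d (m k))
| st_store pc m a s k : nth_error p pc = Some (IStore a s) -> m a = INR k ->
    step p (pc, m) (S pc, upd m k (m s))
| st_jlt_t pc m a b t : nth_error p pc = Some (IJlt a b t) -> m a < m b ->
    step p (pc, m) (t, m)
| st_jlt_f pc m a b t : nth_error p pc = Some (IJlt a b t) -> ~ (m a < m b) ->
    step p (pc, m) (S pc, m)
| st_jeq_t pc m a b t : nth_error p pc = Some (IJeq a b t) -> m a = m b ->
    step p (pc, m) (t, m)
| st_jeq_f pc m a b t : nth_error p pc = Some (IJeq a b t) -> m a <> m b ->
    step p (pc, m) (S pc, m)
| st_jmp pc m t : nth_error p pc = Some (IJmp t) ->
    step p (pc, m) (t, m).

Inductive steps (p : list instr) : state -> nat -> state -> Prop :=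
| steps0 s : steps p s 0 s
| stepsS s s1 t s' : step p s s1 -> steps p s1 t s' -> steps p s (S t) s'.

(* run p m0 t m : started at pc 0 with memory m0, p halts after exactly t
   steps with final memory m (the step relation is deterministic). *)
Definition runs (p : list instr) (m0 : mem) (t : nat) (m : mem) : Prop :=
  exists pc, steps p (0%nat, m0) t (pc, m) /\ nth_error p pc = Some IHalt.

(* Input layout for the construction algorithm:
   m[0] = n, m[1] = eps, m[2+2j] = position of j-th point,
   m[3+2j] = color of j-th point, all other cells 0. *)
Definition build_input (P : list cpoint) (eps : R) : mem :=
  fun i => match i with
  | 0%nat => INR (length P)
  | 1%nat => eps
  | S (S k) =>
      if Nat.ltb (Nat.div k 2) (length P) then
        let q := nth (Nat.div k 2) P (0, 0%nat) in
        if Nat.even k then fst q else INR (snd q)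
      else 0
  end.

(* Output of the construction: m[0] = s (a natural number), and the data
   structure is the list of s reals m[1], ..., m[s]; its size is s. *)
Definition structure_of (m : mem) (s : nat) : list R :=
  map (fun i => m (S i)) (seq 0 s).

(* Input layout for a query [a,b] on data structure D:
   m[0] = a, m[1] = b, m[2+j] = D_j, all other cells 0.
   The answer h is m[0] when the query program halts. *)
Definition query_input (D : list R) (a b : R) : mem :=
  fun i => match i with
  | 0%nat => a
  | 1%nat => b
  | S (S j) => nth j D 0
  end.

(* Main.v *)
Require Import Defs.
From Stdlib Require Import Reals List ZArith Arith Lra Lia Permutation Sorted Classical.
Import ListNotations.
Open Scope R_scope.

(* For a set Q of N points put G(Q) = N * H(Q) = N log N - sum_c N_c log N_c.  By convexity of
   x log x, G grows when a point is added; it is 0 or at least 1, and at most 2 n^2.  So for each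
   left end i the thresholds (1+eps)^t, t < L = O(log n / eps), at which G(points i..e-1) is first
   reached as e grows determine G up to a factor 1+eps.  They take L * n cells; for a fixed t they
   are monotone in i, so two pointers find them all in O(n) time, with colour counts kept in an
   array indexed by the colours themselves.  A query is two binary searches for the ends of the
   window and one among the L thresholds.  This gives even H <= h <= (1+eps) H.  Sorting is a merge
   sort over a queue of runs. *)

(** * Structured programs and their running time *)

(** [H] is not monotone in the window but [G] is, so a query divides by the number of points only at
    its end. Because [G] is 0 or at least 1, the thresholds can start at 1, and a single extra cell
    holding 0 answers every window below the first threshold. The cap [2 n^2] is crude on purpose:
    only its logarithm enters [L], and it is computed without a logarithm, so the program finds [L]
    by multiplying until the cap is reached. The remaining shape comes from the machine. The input
    leaves no free register, so it must be moved before anything can be computed. Colours are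
    arbitrary naturals, so their counters need a region without an upper end: they lie behind
    everything else and rely on untouched cells being 0. Sorting never reuses memory, which keeps
    those cells clean at the price of O(n log n) dead cells. The data structure is simply the prefix
    of the memory up to the counters, registers included. *)

Inductive cmd : Type :=
| Skip
| Do (i : instr)
| Seq (c1 c2 : cmd)
| IfLt (a b : nat) (c1 c2 : cmd)
| WhileLt (a b : nat) (c : cmd).

Notation "c1 ;; c2" := (Seq c1 c2) (at level 80, right associativity).

Fixpoint csize (c : cmd) : nat :=
  match c with
  | Skip => 0
  | Do _ => 1
  | Seq c1 c2 => csize c1 + csize c2
  | IfLt _ _ c1 c2 => 2 + csize c1 + csize c2
  | WhileLt _ _ c => 3 + csize c
  end.

(** Jump targets are absolute, hence the load address [k]. Control always leaves at [k + csize c].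
    In [IfLt] the else branch comes first, because a failing [IJlt] falls through. *)
Fixpoint compile (k : nat) (c : cmd) : list instr :=
  match c with
  | Skip => []
  | Do i => [i]
  | Seq c1 c2 => compile k c1 ++ compile (k + csize c1) c2
  | IfLt a b c1 c2 =>
      IJlt a b (k + 2 + csize c2)
        :: compile (k + 1) c2
        ++ IJmp (k + 2 + csize c2 + csize c1)
        :: compile (k + 2 + csize c2) c1
  | WhileLt a b c =>
      IJlt a b (k + 2) :: IJmp (k + 3 + csize c) :: compile (k + 2) c ++ [IJmp k]
  end.

Lemma compile_length c k : length (compile k c) = csize c.
Proof.
  revert k; induction c; intro k; simpl; auto.
  - rewrite length_app, IHc1, IHc2; reflexivity.
  - rewrite length_app; simpl; rewrite IHc1, IHc2; lia.
  - rewrite length_app; simpl; rewrite IHc; lia.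
Qed.

(** * Total-correctness triples with a step bound *)

Definition code_at (p : list instr) (k : nat) (l : list instr) : Prop :=
  forall j ins, nth_error l j = Some ins -> nth_error p (k + j) = Some ins.

Lemma code_at_app p k l1 l2 :
  code_at p k (l1 ++ l2) -> code_at p k l1 /\ code_at p (k + length l1) l2.
Proof.
  intro H; split; intros j ins Hj.
  - apply H. rewrite nth_error_app1; auto.
    apply nth_error_Some; congruence.
  - rewrite <- Nat.add_assoc. apply H.
    rewrite nth_error_app2 by lia.
    replace (length l1 + j - length l1)%nat with j by lia; auto.
Qed.

Lemma code_at_cons p k i l :
  code_at p k (i :: l) -> nth_error p k = Some i /\ code_at p (k + 1) l.
Proof.
  intro H; split.
  - rewrite <- (Nat.add_0_r k); apply H; reflexivity.
  - intros j ins Hj. rewrite <- Nat.add_assoc. apply H; exact Hj.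
Qed.

Lemma steps_app p s1 t1 s2 t2 s3 :
  steps p s1 t1 s2 -> steps p s2 t2 s3 -> steps p s1 (t1 + t2) s3.
Proof.
  induction 1; intro H2; simpl; auto.
  econstructor; eauto.
Qed.

Lemma steps_one p s1 s2 : step p s1 s2 -> steps p s1 1 s2.
Proof. intro; econstructor; [eassumption | constructor]. Qed.

(** Quantifying over the surrounding program and the load address makes triples compose. The start
    is one concrete memory instead of a precondition, so a proof executes symbolically by updating
    it. The asserted run gives termination within [T] steps. *)
Definition tri (c : cmd) (m : mem) (T : nat) (Q : mem -> Prop) : Prop :=
  forall p k, code_at p k (compile k c) ->
  exists t m', steps p (k, m) t ((k + csize c)%nat, m') /\ (t <= T)%nat /\ Q m'.

Lemma tri_conseq c m T T' (Q Q' : mem -> Prop) :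
  tri c m T Q -> (T <= T')%nat -> (forall m', Q m' -> Q' m') -> tri c m T' Q'.
Proof.
  intros H HT HQ p k Hc. destruct (H p k Hc) as (t & m' & H1 & H2 & H3).
  exists t, m'; repeat split; auto; lia.
Qed.

Lemma tri_skip m T (Q : mem -> Prop) : Q m -> tri Skip m T Q.
Proof.
  intros H p k _. exists 0%nat, m; repeat split; auto; try lia.
  simpl; rewrite Nat.add_0_r; constructor.
Qed.

Lemma tri_seq c1 c2 m T1 T2 T (R Q : mem -> Prop) :
  tri c1 m T1 R -> (forall m', R m' -> tri c2 m' T2 Q) -> (T1 + T2 <= T)%nat ->
  tri (c1 ;; c2) m T Q.
Proof.
  intros H1 H2 HT p k Hc. simpl in Hc. apply code_at_app in Hc as [Hc1 Hc2].
  rewrite compile_length in Hc2.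
  destruct (H1 p k Hc1) as (t1 & m1 & S1 & L1 & Q1).
  destruct (H2 m1 Q1 p _ Hc2) as (t2 & m2 & S2 & L2 & Q2).
  exists (t1 + t2)%nat, m2; repeat split; auto; try lia.
  simpl. rewrite Nat.add_assoc. eapply steps_app; eassumption.
Qed.

Lemma tri_if a b va vb c1 c2 m T (Q : mem -> Prop) : m a = va -> m b = vb ->
  (va < vb -> tri c1 m T Q) -> (~ va < vb -> tri c2 m T Q) ->
  tri (IfLt a b c1 c2) m (S (S T)) Q.
Proof.
  intros <- <- H1 H2 p k Hc. cbn [compile csize] in *.
  apply code_at_cons in Hc as [Hj Hc]. apply code_at_app in Hc as [Hc2 Hc].
  rewrite compile_length in Hc. apply code_at_cons in Hc as [Hm Hc1].
  destruct (Rlt_dec (m a) (m b)) as [Hlt | Hge].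
  - replace (k + 1 + csize c2 + 1)%nat with (k + 2 + csize c2)%nat in Hc1 by lia.
    destruct (H1 Hlt p _ Hc1) as (t & m' & St & Lt & HQ).
    exists (1 + t)%nat, m'; repeat split; auto; try lia.
    replace (k + (2 + csize c1 + csize c2))%nat
      with (k + 2 + csize c2 + csize c1)%nat by lia.
    eapply steps_app; [apply steps_one; eapply st_jlt_t; eassumption | exact St].
  - destruct (H2 Hge p _ Hc2) as (t & m' & St & Lt & HQ).
    exists (1 + t + 1)%nat, m'; repeat split; auto; try lia.
    replace (k + (2 + csize c1 + csize c2))%nat
      with (k + 2 + csize c2 + csize c1)%nat by lia.
    eapply steps_app; [| apply steps_one; eapply st_jmp; eassumption].
    eapply steps_app; [apply steps_one; eapply st_jlt_f; eassumption |].
    rewrite <- (Nat.add_1_r k). exact St.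
Qed.

(* [v] is the time still available: the invariant doubles as the potential. *)
Lemma tri_while a b c (Inv : nat -> mem -> Prop) (Q : mem -> Prop) :
  (forall v m, Inv v m -> m a < m b ->
     exists K, tri c m K (fun m' => exists v', Inv v' m' /\ (v' + K + 2 <= v)%nat)) ->
  (forall v m, Inv v m -> ~ m a < m b -> (2 <= v)%nat /\ Q m) ->
  forall v m, Inv v m -> tri (WhileLt a b c) m v Q.
Proof.
  intros Hbody Hexit v. induction v as [v IH] using lt_wf_ind.
  intros m HI p k Hc. pose proof Hc as Hc0. cbn [compile csize] in *.
  apply code_at_cons in Hc as [Hj Hc]. apply code_at_cons in Hc as [Hm Hc].
  apply code_at_app in Hc as [Hb Hc]. rewrite compile_length in Hc.
  apply code_at_cons in Hc as [Hback _].
  destruct (Rlt_dec (m a) (m b)) as [Hlt | Hge].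
  - destruct (Hbody v m HI Hlt) as (K & HK).
    replace (k + 1 + 1)%nat with (k + 2)%nat in * by lia.
    destruct (HK p _ Hb) as (t & m' & St & Lt & v' & HI' & Hv).
    destruct (IH v' ltac:(lia) m' HI' p k Hc0) as (t' & m'' & St' & Lt' & HQ).
    exists (1 + t + (1 + t'))%nat, m''; repeat split; auto; try lia.
    eapply steps_app.
    + eapply steps_app; [apply steps_one; eapply st_jlt_t; eassumption | exact St].
    + eapply steps_app; [apply steps_one; eapply st_jmp; eassumption | exact St'].
  - destruct (Hexit v m HI Hge) as [Hv HQ].
    exists 2%nat, m; repeat split; auto.
    eapply stepsS; [eapply st_jlt_f; eassumption |].
    apply steps_one. rewrite <- (Nat.add_1_r k).
    replace (k + (3 + csize c))%nat with (k + 3 + csize c)%nat by lia.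
    eapply st_jmp; eassumption.
Qed.

Lemma tri_runs c m T Q :
  tri c m T Q -> exists t m', runs (compile 0 c ++ [IHalt]) m t m' /\ (t <= T)%nat /\ Q m'.
Proof.
  intro H. destruct (H (compile 0 c ++ [IHalt]) 0%nat) as (t & m' & St & Lt & HQ).
  - intros j ins Hj. simpl. rewrite nth_error_app1; auto.
    apply nth_error_Some; congruence.
  - exists t, m'; repeat split; auto. exists (csize c). split; [exact St |].
    rewrite nth_error_app2; rewrite compile_length; [rewrite Nat.sub_diag |]; auto.
Qed.

(** * Symbolic execution of single instructions *)

Lemma tri_do i m m' T (Q : mem -> Prop) :
  (forall p k, nth_error p k = Some i -> step p (k, m) (S k, m')) ->
  Q m' -> tri (Do i) m (S T) Q.
Proof.
  intros H HQ p k Hc. apply code_at_cons in Hc as [Hi _].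
  exists 1%nat, m'; repeat split; auto; try lia.
  simpl. rewrite Nat.add_1_r. apply steps_one, H, Hi.
Qed.

Lemma tri_do_seq i c m m' T Q :
  (forall p k, nth_error p k = Some i -> step p (k, m) (S k, m')) ->
  tri c m' T Q -> tri (Do i ;; c) m (S T) Q.
Proof.
  intros H HQ. apply tri_seq with (T1 := 1%nat) (T2 := T) (R := fun m1 => m1 = m'); try lia.
  - apply tri_do with (m' := m'); auto.
  - intros m1 ->; exact HQ.
Qed.

(** Both nestings compile to the same code. Renesting to the right keeps a single instruction at the
    head, where [stp] can see it. *)
Lemma tri_assoc c1 c2 c3 m T Q :
  tri (c1 ;; (c2 ;; c3)) m T Q -> tri ((c1 ;; c2) ;; c3) m T Q.
Proof.
  intros H p k Hc. cbn [compile csize] in *. rewrite <- app_assoc in Hc.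
  rewrite !Nat.add_assoc in *.
  destruct (H p k) as (t & m' & H1 & H2 & H3); [cbn [compile]; rewrite ?Nat.add_assoc; exact Hc |].
  cbn [csize] in *.
  exists t, m'; repeat split; auto.
  replace (k + csize c1 + csize c2 + csize c3)%nat
   with (k + (csize c1 + (csize c2 + csize c3)))%nat by lia. exact H1.
Qed.

Lemma tri_const d z c m T Q :
  tri c (upd m d (IZR z)) T Q -> tri (Do (IConst d z) ;; c) m (S T) Q.
Proof. apply tri_do_seq; intros; apply st_const; auto. Qed.

Lemma tri_add d a b va vb c m T Q : m a = va -> m b = vb ->
  tri c (upd m d (va + vb)) T Q -> tri (Do (IAdd d a b) ;; c) m (S T) Q.
Proof. intros <- <-. apply tri_do_seq; intros; apply st_add; auto. Qed.

Lemma tri_sub d a b va vb c m T Q : m a = va -> m b = vb ->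
  tri c (upd m d (va - vb)) T Q -> tri (Do (ISub d a b) ;; c) m (S T) Q.
Proof. intros <- <-. apply tri_do_seq; intros; apply st_sub; auto. Qed.

Lemma tri_mul d a b va vb c m T Q : m a = va -> m b = vb ->
  tri c (upd m d (va * vb)) T Q -> tri (Do (IMul d a b) ;; c) m (S T) Q.
Proof. intros <- <-. apply tri_do_seq; intros; apply st_mul; auto. Qed.

Lemma tri_div d a b va vb c m T Q : m a = va -> m b = vb -> vb <> 0 ->
  tri c (upd m d (va / vb)) T Q -> tri (Do (IDiv d a b) ;; c) m (S T) Q.
Proof. intros <- <- Hb. apply tri_do_seq; intros; apply st_div; auto. Qed.

Lemma tri_log2 d a va c m T Q : m a = va -> 0 < va ->
  tri c (upd m d (log2 va)) T Q -> tri (Do (ILog2 d a) ;; c) m (S T) Q.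
Proof. intros <- Ha. apply tri_do_seq; intros; apply st_log2; auto. Qed.

Lemma tri_load k v d a va c m T Q : m a = va -> va = INR k -> m k = v ->
  tri c (upd m d v) T Q -> tri (Do (ILoad d a) ;; c) m (S T) Q.
Proof. intros <- Hk <-. apply tri_do_seq; intros; eapply st_load; eauto. Qed.

Lemma tri_store k a va s vs c m T Q : m a = va -> va = INR k -> m s = vs ->
  tri c (upd m k vs) T Q -> tri (Do (IStore a s) ;; c) m (S T) Q.
Proof. intros <- Hk <-. apply tri_do_seq; intros; eapply st_store; eauto. Qed.

Lemma upd_eq m d v : upd m d v d = v.
Proof. unfold upd; rewrite Nat.eqb_refl; reflexivity. Qed.

Lemma upd_neq m d v x : x <> d -> upd m d v x = m x.
Proof. intro H; unfold upd; destruct (Nat.eqb_spec x d); congruence. Qed.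

Lemma upd_at m d v x : x = d -> upd m d v x = v.
Proof. intros ->; apply upd_eq. Qed.

Lemma tri_do_end i m T Q : tri (Do i ;; Skip) m T Q -> tri (Do i) m T Q.
Proof.
  intros H p k Hc. destruct (H p k) as (t & m' & H1 & H2 & H3); [exact Hc |].
  exists t, m'; auto.
Qed.

Ltac rds := repeat first [rewrite upd_eq | rewrite upd_neq by lia | rewrite upd_at by lia].
Ltac rg := rds; first [eassumption | reflexivity | solve [eauto]].
(* Equalities between reals denoting integers are pushed to Z. *)
Ltac inr :=
  rewrite ?INR_IZR_INZ;
  repeat first [rewrite <- plus_IZR | rewrite <- minus_IZR | rewrite <- mult_IZR];
  first [apply f_equal | apply IZR_lt | apply IZR_le]; first [lia | nia].
Ltac inr_in H :=
  rewrite ?INR_IZR_INZ in H;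
  repeat first [rewrite <- plus_IZR in H | rewrite <- minus_IZR in H
               | rewrite <- mult_IZR in H];
  first [apply lt_IZR in H | apply eq_IZR in H
        | apply Rnot_lt_le in H; apply le_IZR in H].
Ltac stp :=
  lazymatch goal with
  | |- tri ((_ ;; _) ;; _) _ _ _ => apply tri_assoc
  | |- tri (Do (IConst _ _) ;; _) _ _ _ => apply tri_const
  | |- tri (Do (IAdd _ _ _) ;; _) _ _ _ => eapply tri_add; [rg | rg |]
  | |- tri (Do (ISub _ _ _) ;; _) _ _ _ => eapply tri_sub; [rg | rg |]
  | |- tri (Do (IMul _ _ _) ;; _) _ _ _ => eapply tri_mul; [rg | rg |]
  | |- tri (Do _) _ _ _ => apply tri_do_end
  end.
(** Loads and stores need their address as a natural number, which unification cannot extract from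
    the real in the register; it is supplied by hand. *)
Ltac ldk k := eapply (tri_load k); [rg | try inr | rg |].
Ltac stk k := eapply (tri_store k); [rg | try inr | rg |].
Ltac setv v' :=
  lazymatch goal with |- tri _ (upd _ _ ?v) _ _ => replace v with v' end.

(** * Relocating the input *)

(* During construction cells 0..63 serve as registers. *)
Notation rzero := 2%nat (only parsing).
Notation rone := 3%nat (only parsing).
Notation rn := 4%nat (only parsing).
Notation reps := 5%nat (only parsing).
Notation rh := 6%nat (only parsing).
Notation ro := 7%nat (only parsing).
Notation rk := 8%nat (only parsing).
Notation ri := 9%nat (only parsing).
Notation rie := 10%nat (only parsing).
Notation rj := 11%nat (only parsing).
Notation rje := 12%nat (only parsing).
Notation rr := 13%nat (only parsing).
Notation rx := 14%nat (only parsing).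
Notation ry := 15%nat (only parsing).

(** * Point lists and queues of runs in memory *)

Fixpoint pts (m : mem) (a : nat) (l : list cpoint) : Prop :=
  match l with
  | [] => True
  | p :: l' => m a = fst p /\ m (a + 1)%nat = INR (snd p) /\ pts m (a + 2) l'
  end.

Fixpoint runs_at (m : mem) (a : nat) (ls : list (list cpoint)) : Prop :=
  match ls with
  | [] => True
  | l :: ls' => m a = INR (length l) /\ pts m (a + 1) l
                /\ runs_at m (a + 1 + 2 * length l) ls'
  end.

Definition qsize (ls : list (list cpoint)) : nat :=
  length ls + 2 * length (concat ls).

Lemma pts_frame m m' a l :
  pts m a l -> (forall x, (a <= x < a + 2 * length l)%nat -> m' x = m x) -> pts m' a l.
Proof.
  revert a; induction l as [|p l IH]; simpl; auto.
  intros a (H1 & H2 & H3) Hf. rewrite !Hf by lia.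
  repeat split; auto. apply IH; auto. intros; apply Hf; lia.
Qed.

Lemma pts_app m a l1 l2 :
  pts m a (l1 ++ l2) <-> pts m a l1 /\ pts m (a + 2 * length l1) l2.
Proof.
  revert a; induction l1 as [|p l IH]; intro a; cbn [app pts length].
  - rewrite Nat.mul_0_r, Nat.add_0_r; tauto.
  - rewrite IH. replace (a + 2 + 2 * length l)%nat with (a + 2 * S (length l))%nat by lia.
    tauto.
Qed.

Lemma pts_nth m a l i d : pts m a l -> (i < length l)%nat ->
  m (a + 2 * i)%nat = fst (nth i l d) /\ m (a + 2 * i + 1)%nat = INR (snd (nth i l d)).
Proof.
  revert a i; induction l as [|p l IH]; intros a i H Hi; [simpl in Hi; lia |].
  destruct H as (H1 & H2 & H3). destruct i as [|i]; cbn [nth length] in *.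
  - rewrite Nat.mul_0_r, Nat.add_0_r; auto.
  - replace (a + 2 * S i)%nat with (a + 2 + 2 * i)%nat by lia. apply IH; auto; lia.
Qed.

Lemma qsize_cons l ls : qsize (l :: ls) = (1 + 2 * length l + qsize ls)%nat.
Proof. unfold qsize; simpl; rewrite length_app; lia. Qed.

Lemma qsize_app l1 l2 : qsize (l1 ++ l2) = (qsize l1 + qsize l2)%nat.
Proof. unfold qsize; rewrite concat_app, !length_app; lia. Qed.

Lemma runs_at_frame m m' a ls :
  runs_at m a ls -> (forall x, (a <= x < a + qsize ls)%nat -> m' x = m x) ->
  runs_at m' a ls.
Proof.
  revert a; induction ls as [|l ls IH]; simpl; auto.
  intros a (H1 & H2 & H3) Hf. rewrite qsize_cons in Hf.
  rewrite Hf by lia. repeat split; auto.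
  - eapply pts_frame; eauto. intros; apply Hf; lia.
  - apply IH; auto. intros; apply Hf; lia.
Qed.

Lemma runs_at_app m a l1 l2 :
  runs_at m a (l1 ++ l2) <-> runs_at m a l1 /\ runs_at m (a + qsize l1) l2.
Proof.
  revert a; induction l1 as [|l ls IH]; intro a; cbn [app runs_at].
  - rewrite Nat.add_0_r; tauto.
  - rewrite IH, qsize_cons.
    replace (a + 1 + 2 * length l + qsize ls)%nat
      with (a + (1 + 2 * length l + qsize ls))%nat by lia. tauto.
Qed.

(** Unrolled over literal register numbers, since no cell is free for a loop counter. Cell 0 is the
    moving target address and cell 1 must hold 1. *)
Definition reloc_cells (xs : list nat) : cmd :=
  fold_right (fun x c => Do (IAdd 0 0 1) ;; Do (IStore 0 x) ;; c) Skip xs.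

Lemma reloc_cells_spec base cnt : forall x m,
  m 1%nat = 1 -> m 0%nat = INR (base + x) -> (64 <= base)%nat -> (2 + x + cnt <= 64)%nat ->
  tri (reloc_cells (seq (2 + x) cnt)) m (2 * cnt) (fun m' =>
    m' 0%nat = INR (base + x + cnt) /\
    (forall y, (1 <= y)%nat -> (y < base + 1 + x \/ base + 1 + x + cnt <= y)%nat -> m' y = m y) /\
    (forall y, (x <= y < x + cnt)%nat -> m' (base + 1 + y)%nat = m (2 + y)%nat)).
Proof.
  induction cnt as [|cnt IH]; intros x m H1 H0 Hb Hx.
  - apply tri_skip. rewrite Nat.add_0_r. repeat split; auto; intros; lia.
  - replace (2 * S cnt)%nat with (S (S (2 * cnt))) by lia.
    cbn [seq reloc_cells fold_right]. stp. stk (base + 1 + x)%nat.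
    eapply tri_conseq; [apply (IH (S x)) | lia |]; try lia.
    + rg.
    + rds. inr.
    + intros m' (A & B & C). repeat split.
      * rewrite A. inr.
      * intros y Hy Hy'. rewrite B by lia. rds; auto.
      * intros y Hy. destruct (Nat.eq_dec y x) as [-> | Hne].
        -- rewrite B by lia. rds; auto.
        -- rewrite C by lia. rds; auto.
Qed.

(* Initially the input fills all low cells.  Doubling cell 0, the only operation that needs no free
   cell, yields an address 64 n beyond the input; eps goes there, which frees cell 1. *)
Definition reloc : cmd :=
  Do (IAdd 0 0 0) ;; Do (IAdd 0 0 0) ;; Do (IAdd 0 0 0) ;;
  Do (IAdd 0 0 0) ;; Do (IAdd 0 0 0) ;; Do (IAdd 0 0 0) ;;
  Do (IStore 0 1) ;; Do (IConst 1 1) ;; reloc_cells (seq 2 62).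

Lemma reloc_spec n m0 : m0 0%nat = INR n -> (1 <= n)%nat ->
  tri reloc m0 132 (fun m =>
    m 0%nat = INR (64 * n + 62) /\ m (64 * n)%nat = m0 1%nat /\
    (forall y, (2 <= y)%nat -> (y < 64 * n \/ 64 * n + 63 <= y)%nat -> m y = m0 y) /\
    (forall y, (y < 62)%nat -> m (64 * n + 1 + y)%nat = m0 (2 + y)%nat)).
Proof.
  intros H0 Hn. unfold reloc.
  do 6 stp. stk (64 * n)%nat. stp.
  eapply tri_conseq; [apply (reloc_cells_spec (64 * n) 62 0) | |]; try lia.
  - rg.
  - rds. inr.
  - intros m (A & B & C). repeat split.
    + rewrite A. f_equal; lia.
    + rewrite B by lia. rds; auto.
    + intros y Hy Hy'. rewrite B by lia. rds; auto.
    + intros y Hy. rewrite C by lia. rds; auto.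
Qed.

(** After [reloc] the only trace of [n] is [64 n + 62] in cell 0: subtracting 62 gives the address
    of [eps], dividing by 64 gives [n]. The first 31 points are read from their copies and the
    others in place; [rj] and [rje] follow both possible addresses of the current point, and
    comparing [rj] with 64 selects one. The queue of one-point runs starts at [128 n], past the
    input and the copies. *)
Definition init : cmd :=
  reloc ;;
  Do (IConst rzero 0) ;; Do (IConst rone 1) ;; Do (IConst rx 62) ;; Do (ISub 0 0 rx) ;;
  Do (ILoad reps 0) ;; Do (IConst rx 64) ;; Do (IDiv rn 0 rx) ;;
  Do (IAdd rh 0 0) ;; Do (IAdd ro 0 0) ;; Do (IConst ri 0) ;; Do (IConst rj 2) ;;
  Do (IAdd rje 0 rone) ;; Do (IConst rr 2) ;;
  WhileLt ri rn
    (IfLt rj rx (Do (IAdd ry rje rzero)) (Do (IAdd ry rj rzero)) ;;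
     Do (IStore ro rone) ;; Do (IAdd ro ro rone) ;;
     Do (ILoad rk ry) ;; Do (IStore ro rk) ;; Do (IAdd ro ro rone) ;; Do (IAdd ry ry rone) ;;
     Do (ILoad rk ry) ;; Do (IStore ro rk) ;; Do (IAdd ro ro rone) ;;
     Do (IAdd rj rj rr) ;; Do (IAdd rje rje rr) ;; Do (IAdd ri ri rone)).

Lemma firstn_S_nth {A} (l : list A) i d :
  (i < length l)%nat -> firstn (S i) l = firstn i l ++ [nth i l d].
Proof.
  revert i; induction l as [|x l IH]; intros [|i] H; simpl in *; try lia; auto.
  rewrite <- IH by lia; reflexivity.
Qed.

Lemma qsize_singletons (l : list cpoint) : qsize (map (fun p => [p]) l) = (3 * length l)%nat.
Proof.
  induction l as [|p l IH]; auto. rewrite map_cons, qsize_cons, IH. simpl; lia.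
Qed.

Lemma init_spec P eps : (1 <= length P)%nat ->
  let n := length P in
  tri init (build_input P eps) (20 * n + 160) (fun m =>
    m rzero = 0 /\ m rone = 1 /\ m rn = INR n /\ m reps = eps /\
    m rh = INR (128 * n) /\ m ro = INR (128 * n + 3 * n) /\
    runs_at m (128 * n) (map (fun p => [p]) P) /\
    (forall y, (131 * n <= y)%nat -> m y = 0)).
Proof.
  intros Hn n. unfold init. set (m0 := build_input P eps).
  assert (Hpos : forall j, (j < n)%nat -> m0 (2 + 2 * j)%nat = fst (nth j P (0, 0%nat))
                   /\ m0 (3 + 2 * j)%nat = INR (snd (nth j P (0, 0%nat)))).
  { intros j Hj. unfold m0, build_input.
    change (3 + 2 * j)%nat with (S (S (1 + 2 * j))).
    change (2 + 2 * j)%nat with (S (S (2 * j))). cbv iota zeta.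
    replace (2 * j / 2)%nat with j by (rewrite Nat.mul_comm, Nat.div_mul; lia).
    replace ((1 + 2 * j) / 2)%nat with j
      by (rewrite (Nat.mul_comm 2), Nat.div_add by lia; reflexivity).
    destruct (Nat.ltb_spec j (length P)) as [_ | ?]; [| unfold n in *; lia].
    rewrite Nat.even_mul, Nat.even_add, Nat.even_mul. auto. }
  assert (Hz : forall y, (2 * n + 2 <= y)%nat -> m0 y = 0).
  { intros y Hy. unfold m0, build_input. destruct y as [|[|y]]; try lia.
    destruct (Nat.ltb_spec (y / 2) (length P)) as [H | ?]; auto.
    assert (y < 2 * n)%nat; [| lia].
    pose proof (Nat.div_mod y 2 ltac:(lia)). pose proof (Nat.mod_upper_bound y 2 ltac:(lia)).
    unfold n; lia. }
  fold n in Hn.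
  apply tri_seq with (T1 := 132%nat) (T2 := (20 * n + 28)%nat)
    (R := fun m =>
    m 0%nat = INR (64 * n + 62) /\ m (64 * n)%nat = m0 1%nat /\
    (forall y, (2 <= y)%nat -> (y < 64 * n \/ 64 * n + 63 <= y)%nat -> m y = m0 y) /\
    (forall y, (y < 62)%nat -> m (64 * n + 1 + y)%nat = m0 (2 + y)%nat)); [| | lia].
  { apply reloc_spec; auto. }
  intros m (H0 & Heps & Hsame & Hcopy). change (m0 1%nat) with eps in Heps.
  replace (20 * n + 28)%nat with (13 + (20 * n + 15))%nat by lia.
  do 4 stp. ldk (64 * n)%nat. stp.
  eapply tri_div; [rg | rg | lra |]. setv (INR n).
  2:{ rewrite plus_INR, mult_INR. simpl (INR 64). simpl (INR 62). field. }
  do 6 stp.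
  set (Inv := fun (v : nat) (m' : mem) => exists i, (i <= n)%nat /\ v = (2 + 20 * (n - i))%nat /\
    m' rzero = 0 /\ m' rone = 1 /\ m' rn = INR n /\ m' reps = eps /\
    m' rh = INR (128 * n) /\ m' ro = INR (128 * n + 3 * i) /\
    m' ri = INR i /\ m' rj = INR (2 + 2 * i) /\ m' rje = INR (64 * n + 1 + 2 * i) /\
    m' rx = 64 /\ m' rr = 2 /\
    (forall y, (64 <= y < 64 * n)%nat -> m' y = m0 y) /\
    (forall y, (y < 62)%nat -> m' (64 * n + 1 + y)%nat = m0 (2 + y)%nat) /\
    runs_at m' (128 * n) (map (fun p => [p]) (firstn i P)) /\
    (forall y, (128 * n + 3 * i <= y)%nat -> m' y = 0)).
  eapply tri_conseq; [apply tri_while with (Inv := Inv) (v := (2 + 20 * n)%nat) | lia | intros m' H; exact H].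
  - intros v m' (i & Hi & -> & Rz & R1 & Rn & Re & Rh & Ro & Ri & Rj & Rje & Rx & Rr & F1 & F2 & F3 & F4) Hc.
    rewrite Ri, Rn in Hc. apply INR_lt in Hc. exists 18%nat.
    set (src := if (2 + 2 * i <? 64)%nat then (64 * n + 1 + 2 * i)%nat else (2 + 2 * i)%nat).
    destruct (Hpos i Hc) as [Hp1 Hp2].
    assert (Hs : m' src = fst (nth i P (0, 0%nat)) /\ m' (src + 1)%nat = INR (snd (nth i P (0, 0%nat)))).
    { unfold src. destruct (Nat.ltb_spec (2 + 2 * i) 64).
      - rewrite F2 by lia. rewrite <- Nat.add_assoc, F2 by lia. split; auto.
        rewrite <- Hp2. f_equal; lia.
      - rewrite !F1 by lia. split; auto. rewrite <- Hp2. f_equal; lia. }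
    assert (Hsr : (64 <= src < 128 * n - 1)%nat)
      by (unfold src; destruct (Nat.ltb_spec (2 + 2 * i) 64); lia).
    destruct Hs as [Hs1 Hs2].
    apply tri_seq with (T1 := 3%nat) (T2 := 15%nat) (R := fun m1 => m1 = upd m' ry (INR src)); [| | lia].
    { eapply tri_if; [rg | rg | |]; intro Hlt; stp; stp; apply tri_skip; f_equal; unfold src.
      - destruct (Nat.ltb_spec (2 + 2 * i) 64); [ring |].
        exfalso. apply (Rlt_not_le _ _ Hlt). inr.
      - destruct (Nat.ltb_spec (2 + 2 * i) 64); [| ring].
        exfalso. apply Hlt. inr. }
    intros m1 ->.
    stk (128 * n + 3 * i)%nat. stp. ldk src. stk (128 * n + 3 * i + 1)%nat. do 2 stp.
    ldk (src + 1)%nat. stk (128 * n + 3 * i + 2)%nat. do 5 stp. apply tri_skip.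
    exists (2 + 20 * (n - S i))%nat. split; [| lia].
    exists (S i).
    repeat match goal with |- _ /\ _ => split end; rds; auto; try lia; try inr.
    + intros y Hy. rds. auto.
    + intros y Hy. rds. auto.
    + rewrite (firstn_S_nth P i (0, 0%nat)) by auto. rewrite map_app. apply runs_at_app. split.
      * eapply runs_at_frame; eauto. intros y Hy. rewrite qsize_singletons, length_firstn in Hy.
        rds. auto.
      * rewrite qsize_singletons, length_firstn. rewrite Nat.min_l by (unfold n in *; lia).
        cbn [map runs_at pts length fst snd]. repeat split; rds; auto.
    + intros y Hy. rds. apply F4; lia.
  - intros v m' (i & Hi & -> & Rz & R1 & Rn & Re & Rh & Ro & Ri & Rj & Rje & Rx & Rr & F1 & F2 & F3 & F4) Hc.
    rewrite Ri, Rn in Hc. inr_in Hc. assert (i = n) by lia. subst i. split; [lia |].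
    unfold n in F3; rewrite firstn_all in F3. repeat split; auto. intros; apply F4; lia.
  - exists 0%nat. repeat match goal with |- _ /\ _ => split end; rds; auto; try lia; try inr.
    + intros y Hy. rds. apply Hsame; lia.
    + intros y Hy. rds. auto.
    + exact I.
    + intros y Hy. rds. rewrite Hsame by lia. apply Hz; lia.
Qed.

(** * Merge sort *)

Definition ple (p q : cpoint) : Prop := fst p <= fst q.

Lemma StronglySorted_snoc (l : list cpoint) p :
  StronglySorted ple l -> (forall q, In q l -> ple q p) -> StronglySorted ple (l ++ [p]).
Proof.
  induction l as [|x l IH]; simpl; intros Hs Hp.
  - repeat constructor.
  - apply StronglySorted_inv in Hs as [Hs Hx]. constructor; auto.
    apply Forall_app; split; auto.
Qed.

Lemma StronglySorted_head (l : list cpoint) p q :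
  StronglySorted ple (p :: l) -> In q (p :: l) -> ple p q.
Proof.
  intros Hs [-> | Hin]; [apply Rle_refl |].
  apply StronglySorted_inv in Hs as [_ Hf]. rewrite Forall_forall in Hf; auto.
Qed.

Definition take (r : nat) : cmd :=
  Do (ILoad rx r) ;; Do (IStore ro rx) ;; Do (IAdd ro ro rone) ;; Do (IAdd r r rone) ;;
  Do (ILoad rx r) ;; Do (IStore ro rx) ;; Do (IAdd ro ro rone) ;; Do (IAdd r r rone).

Lemma take_spec r m a o p : r = ri \/ r = rj ->
  m r = INR a -> m ro = INR o -> m rone = 1 -> m a = fst p -> m (a + 1)%nat = INR (snd p) ->
  (64 <= a)%nat -> (a + 2 <= o)%nat ->
  tri (take r) m 8 (fun m' => m' r = INR (a + 2) /\ m' ro = INR (o + 2) /\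
    m' o = fst p /\ m' (o + 1)%nat = INR (snd p) /\
    forall y, y <> r -> y <> ro -> y <> rx -> y <> o -> y <> (o + 1)%nat -> m' y = m y).
Proof.
  intros Hr H1 H2 H3 H4 H5 Ha Ho. unfold take.
  destruct Hr as [-> | ->]; ldk a; stk o; do 2 stp; ldk (a + 1)%nat; stk (o + 1)%nat;
  do 3 stp; apply tri_skip;
  repeat match goal with |- _ /\ _ => split end; rds; auto; try inr; intros; rds; auto.
Qed.

(** Each round moves exactly one point and [rr] counts those still to be moved, so an exhausted run
    needs no separate copying loop. *)
Definition merge_loop : cmd :=
  WhileLt rzero rr
    (IfLt ri rie
       (IfLt rj rje
          (Do (ILoad rx ri) ;; Do (ILoad ry rj) ;; IfLt ry rx (take rj) (take ri))
          (take ri))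
       (take rj) ;;
     Do (ISub rr rr rone)).

(** The invariant splits the points into the output [d] and the unread rests [r1], [r2], with
    everything in [d] below everything unread. The output address lies past both inputs, so no
    unread point is overwritten. *)
Lemma merge_loop_spec m i j o l1 l2 :
  m rzero = 0 -> m rone = 1 -> m ri = INR i -> m rie = INR (i + 2 * length l1) ->
  m rj = INR j -> m rje = INR (j + 2 * length l2) -> m ro = INR o ->
  m rr = INR (length l1 + length l2) ->
  (64 <= i)%nat -> (i + 2 * length l1 <= j)%nat -> (j + 2 * length l2 < o)%nat ->
  pts m i l1 -> pts m j l2 -> StronglySorted ple l1 -> StronglySorted ple l2 ->
  tri merge_loop m (20 * (length l1 + length l2) + 2) (fun m' => exists l,
    StronglySorted ple l /\ Permutation l (l1 ++ l2) /\ pts m' o l /\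
    m' ro = INR (o + 2 * length l) /\
    forall y, (y <= rk \/ rr < y < o \/ o + 2 * length l <= y \/ y = rie \/ y = rje)%nat ->
      y <> ro -> y <> rx -> y <> ry -> m' y = m y).
Proof.
  intros Hz H1 Hi Hie Hj Hje Ho Hr Bi Bij Bjo P1 P2 S1 S2. unfold merge_loop.
  set (Inv := fun (v : nat) (m' : mem) => exists d r1 r2,
    v = (20 * (length r1 + length r2) + 2)%nat /\
    (length r1 <= length l1)%nat /\ (length r2 <= length l2)%nat /\
    Permutation (d ++ r1 ++ r2) (l1 ++ l2) /\
    StronglySorted ple d /\ StronglySorted ple r1 /\ StronglySorted ple r2 /\
    (forall p q, In p d -> In q (r1 ++ r2) -> ple p q) /\
    m' ri = INR (i + 2 * length l1 - 2 * length r1) /\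
    m' rj = INR (j + 2 * length l2 - 2 * length r2) /\
    m' ro = INR (o + 2 * length d) /\ m' rr = INR (length r1 + length r2) /\
    pts m' (i + 2 * length l1 - 2 * length r1) r1 /\
    pts m' (j + 2 * length l2 - 2 * length r2) r2 /\
    pts m' o d /\
    (forall y, (y <= rk \/ rr < y < o \/ o + 2 * length d <= y \/ y = rie \/ y = rje)%nat ->
      y <> ro -> y <> rx -> y <> ry -> m' y = m y)).
  apply tri_while with (Inv := Inv).
  - intros v m' (d & r1 & r2 & -> & L1 & L2 & Hp & Sd & Sr1 & Sr2 & Hle & Ri & Rj & Ro & Rr
                 & Q1 & Q2 & Qd & Fr) Hc.
    assert (Rz : m' rzero = 0) by (rewrite Fr by lia; auto).
    assert (R1 : m' rone = 1) by (rewrite Fr by lia; auto).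
    assert (Rie : m' rie = INR (i + 2 * length l1)) by (rewrite Fr by lia; auto).
    assert (Rje : m' rje = INR (j + 2 * length l2)) by (rewrite Fr by lia; auto).
    rewrite Rz, Rr in Hc. change 0 with (INR 0) in Hc. apply INR_lt in Hc.
    exists 18%nat.
    (* All five control paths end in one of two cases, according to the run that supplied the next
       point [p]. Only the comparison with the other run is recorded; sortedness settles the run of
       [p] itself. *)
    apply tri_seq with (T1 := 17%nat) (T2 := 1%nat) (R := fun m1 =>
      m1 rone = 1 /\ m1 rr = m' rr /\
      ((exists p r1', r1 = p :: r1' /\ (forall q, In q r2 -> ple p q) /\
         m1 ri = INR (i + 2 * length l1 - 2 * length r1') /\ m1 rj = m' rj /\
         m1 ro = INR (o + 2 * length (d ++ [p])) /\
         m1 (o + 2 * length d)%nat = fst p /\ m1 (o + 2 * length d + 1)%nat = INR (snd p) /\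
         (forall y, y <> ri -> y <> ro -> y <> rx -> y <> ry -> y <> (o + 2 * length d)%nat ->
            y <> (o + 2 * length d + 1)%nat -> m1 y = m' y)) \/
       (exists p r2', r2 = p :: r2' /\ (forall q, In q r1 -> ple p q) /\
         m1 ri = m' ri /\ m1 rj = INR (j + 2 * length l2 - 2 * length r2') /\
         m1 ro = INR (o + 2 * length (d ++ [p])) /\
         m1 (o + 2 * length d)%nat = fst p /\ m1 (o + 2 * length d + 1)%nat = INR (snd p) /\
         (forall y, y <> rj -> y <> ro -> y <> rx -> y <> ry -> y <> (o + 2 * length d)%nat ->
            y <> (o + 2 * length d + 1)%nat -> m1 y = m' y)))); [| | lia].
    + eapply tri_if; [rg | rg | |]; intro Hci.
      * inr_in Hci. destruct r1 as [|p r1']; [simpl in Hci; lia |].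
        cbn [length pts] in *. destruct Q1 as (Q1a & Q1b & Q1c).
        eapply tri_if; [rg | rg | |]; intro Hcj.
        -- inr_in Hcj. destruct r2 as [|q r2']; [simpl in Hcj; lia |].
           cbn [length pts] in *. destruct Q2 as (Q2a & Q2b & Q2c).
           ldk (i + 2 * length l1 - 2 * S (length r1'))%nat.
           ldk (j + 2 * length l2 - 2 * S (length r2'))%nat.
           eapply tri_if; [rg | rg | |]; intro Hpq.
           ++ eapply tri_conseq; [eapply take_spec with (p := q); [right; reflexivity | rg ..| |] | |];
                try lia.
              intros m1 (A & B & C & D & E).
              split; [rewrite E by lia; rds; auto |]. split; [rewrite E by lia; rds; auto |].
              right. exists q, r2'. split; auto. split.
              { intros x Hx. apply Rle_trans with (fst p); [left; exact Hpq |].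
                apply (StronglySorted_head r1' p x); auto. }
              split; [rewrite E by lia; rds; auto |].
              split; [rewrite A; f_equal; lia |].
              split; [rewrite B, length_app; f_equal; simpl; lia |].
              split; auto. split; auto. intros y *. intros. rewrite E by lia. rds; auto.
           ++ eapply tri_conseq; [eapply take_spec with (p := p); [left; reflexivity | rg ..| |] | |];
                try lia.
              intros m1 (A & B & C & D & E).
              split; [rewrite E by lia; rds; auto |]. split; [rewrite E by lia; rds; auto |].
              left. exists p, r1'. split; auto. split.
              { intros x Hx. apply Rle_trans with (fst q); [apply Rnot_lt_le; exact Hpq |].
                apply (StronglySorted_head r2' q x); auto. }
              split; [rewrite A; f_equal; lia |].
              split; [rewrite E by lia; rds; auto |].
              split; [rewrite B, length_app; f_equal; simpl; lia |].
              split; auto. split; auto. intros y *. intros. rewrite E by lia. rds; auto.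
        -- inr_in Hcj. destruct r2 as [|q r2']; [| simpl in Hcj, L2; lia].
           eapply tri_conseq; [eapply take_spec with (p := p); [left; reflexivity | rg ..| |] | |];
             try lia.
           intros m1 (A & B & C & D & E).
           split; [rewrite E by lia; rds; auto |]. split; [rewrite E by lia; rds; auto |].
           left. exists p, r1'. split; auto. split; [intros x [] |].
           split; [rewrite A; f_equal; lia |].
           split; [rewrite E by lia; rds; auto |].
           split; [rewrite B, length_app; f_equal; simpl; lia |].
           split; auto.
      * inr_in Hci. destruct r1 as [|p r1']; [| simpl in Hci, L1; lia].
        destruct r2 as [|q r2']; [simpl in Hc; lia |].
        cbn [length pts] in *. destruct Q2 as (Q2a & Q2b & Q2c).
        eapply tri_conseq; [eapply take_spec with (p := q); [right; reflexivity | rg ..| |] | |];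
          try lia.
        intros m1 (A & B & C & D & E).
        split; [rewrite E by lia; rds; auto |]. split; [rewrite E by lia; rds; auto |].
        right. exists q, r2'. split; auto. split; [intros x [] |].
        split; [rewrite E by lia; rds; auto |].
        split; [rewrite A; f_equal; lia |].
        split; [rewrite B, length_app; f_equal; simpl; lia |].
        split; auto.
    + intros m1 (M1 & Mr & Hm). rewrite Rr in Mr. stp. stp. apply tri_skip.
      destruct Hm as [(p & r1' & -> & Hpq & Mi & Mj & Mo & Mp1 & Mp2 & F)
                     | (p & r2' & -> & Hpq & Mi & Mj & Mo & Mp1 & Mp2 & F)];
      cbn [length pts] in *.
      * exists (20 * (length r1' + length r2) + 2)%nat. split; [| lia].
        destruct Q1 as (Q1a & Q1b & Q1c).
        apply StronglySorted_inv in Sr1 as [Sr1 Sp]. rewrite Forall_forall in Sp.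
        exists (d ++ [p]), r1', r2. rewrite Rj in Mj.
        repeat match goal with |- _ /\ _ => split end; rds; auto; try lia; try inr.
        -- rewrite <- app_assoc. exact Hp.
        -- apply StronglySorted_snoc; auto. intros q Hq. apply Hle; auto. left; auto.
        -- intros x y Hx Hy. apply in_app_or in Hx as [Hx | [<- | []]].
           ++ apply Hle; auto. right; auto.
           ++ apply in_app_or in Hy as [Hy | Hy]; auto.
        -- eapply pts_frame.
           { replace (i + 2 * length l1 - 2 * length r1')%nat
              with (i + 2 * length l1 - 2 * S (length r1') + 2)%nat by lia. exact Q1c. }
           intros y Hy. rds. apply F; lia.
        -- eapply pts_frame; eauto. intros y Hy. rds. apply F; lia.
        -- apply pts_app. split.
           ++ eapply pts_frame; eauto. intros y Hy. rds. apply F; lia.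
           ++ cbn [pts]. rds. auto.
        -- intros y Hy Hy1 Hy2 Hy3. rewrite length_app in Hy. simpl in Hy. rds. rewrite F by lia. apply Fr; lia.
      * exists (20 * (length r1 + length r2') + 2)%nat. split; [| lia].
        destruct Q2 as (Q2a & Q2b & Q2c).
        apply StronglySorted_inv in Sr2 as [Sr2 Sp]. rewrite Forall_forall in Sp.
        exists (d ++ [p]), r1, r2'. rewrite Ri in Mi.
        repeat match goal with |- _ /\ _ => split end; rds; auto; try lia; try inr.
        -- eapply Permutation_trans; [| exact Hp]. rewrite <- app_assoc.
           apply Permutation_app_head. exact (Permutation_middle r1 r2' p).
        -- apply StronglySorted_snoc; auto. intros q Hq. apply Hle; auto.
           apply in_or_app; right; left; auto.
        -- intros x y Hx Hy. apply in_app_or in Hx as [Hx | [<- | []]].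
           ++ apply Hle; auto. apply in_or_app. apply in_app_or in Hy as [Hy | Hy]; [left | right; right]; auto.
           ++ apply in_app_or in Hy as [Hy | Hy]; auto.
        -- eapply pts_frame; eauto. intros y Hy. rds. apply F; lia.
        -- eapply pts_frame.
           { replace (j + 2 * length l2 - 2 * length r2')%nat
              with (j + 2 * length l2 - 2 * S (length r2') + 2)%nat by lia. exact Q2c. }
           intros y Hy. rds. apply F; lia.
        -- apply pts_app. split.
           ++ eapply pts_frame; eauto. intros y Hy. rds. apply F; lia.
           ++ cbn [pts]. rds. auto.
        -- intros y Hy Hy1 Hy2 Hy3. rewrite length_app in Hy. simpl in Hy. rds. rewrite F by lia. apply Fr; lia.
  - intros v m' (d & r1 & r2 & -> & L1 & L2 & Hp & Sd & Sr1 & Sr2 & Hle & Ri & Rj & Ro & Rr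
                 & Q1 & Q2 & Qd & Fr) Hc.
    rewrite (Fr rzero) in Hc by lia. rewrite Hz, Rr in Hc. inr_in Hc.
    destruct r1; [| simpl in Hc; lia]. destruct r2; [| simpl in Hc; lia].
    split; [lia |]. exists d. rewrite app_nil_r in Hp. auto.
  - exists [], l1, l2.
    repeat match goal with |- _ /\ _ => split end; auto; try lia.
    + constructor.
    + intros p q [].
    + rewrite Hi. f_equal; lia.
    + rewrite Hj. f_equal; lia.
    + rewrite Ho. f_equal; simpl; lia.
    + replace (i + 2 * length l1 - 2 * length l1)%nat with i by lia; auto.
    + replace (j + 2 * length l2 - 2 * length l2)%nat with j by lia; auto.
    + exact I.
Qed.

(** The queue advances through fresh memory: merged runs are written at [ro], and [rh] jumps over
    the two consumed runs to [rje], the end of the second. [rk] counts the merges left. *)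
Definition merge_sort : cmd :=
  Do (ISub rk rn rone) ;;
  WhileLt rzero rk
    (Do (ILoad rx rh) ;; Do (IAdd ri rh rone) ;; Do (IAdd rie ri rx) ;; Do (IAdd rie rie rx) ;;
     Do (ILoad ry rie) ;; Do (IAdd rj rie rone) ;; Do (IAdd rje rj ry) ;; Do (IAdd rje rje ry) ;;
     Do (IAdd rr rx ry) ;; Do (IStore ro rr) ;; Do (IAdd ro ro rone) ;;
     merge_loop ;;
     Do (IAdd rh rje rzero) ;; Do (ISub rk rk rone)).

(* The runs of a queue of length [q] sit at the nodes [2q-1, 2q-2, ..., q] of a binary heap
   and merging the first two moves to their parent, one level up; hence [phi (2q-1)] drops by
   exactly the length of the merged run. *)
Fixpoint phi (v : nat) (ls : list (list cpoint)) : nat :=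
  match ls with
  | [] => 0
  | l :: ls' => length l * Nat.log2 v + phi (v - 1) ls'
  end.

Lemma phi_snoc v ls l :
  phi v (ls ++ [l]) = (phi v ls + length l * Nat.log2 (v - length ls))%nat.
Proof.
  revert v; induction ls as [|x ls IH]; intro v; cbn [app phi length].
  - rewrite Nat.sub_0_r; lia.
  - rewrite IH. replace (v - 1 - length ls)%nat with (v - S (length ls))%nat by lia. lia.
Qed.

(** With [q] runs before the merge, the untouched ones keep the nodes [2q-3, ..., q], and the merged
    run takes [q-1], the common parent of [2q-1] and [2q-2], whose [log2] is smaller by one. *)
Lemma phi_merge l1 l2 ls l : length l = (length l1 + length l2)%nat ->
  phi (2 * length (l1 :: l2 :: ls) - 1) (l1 :: l2 :: ls) =
  (phi (2 * length (ls ++ [l]) - 1) (ls ++ [l]) + length l)%nat.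
Proof.
  intro Hl. rewrite phi_snoc. rewrite length_app. cbn [length phi].
  replace (2 * S (S (length ls)) - 1)%nat with (2 * S (length ls) + 1)%nat by lia.
  rewrite Nat.log2_succ_double by lia.
  replace (2 * S (length ls) + 1 - 1)%nat with (2 * S (length ls))%nat by lia.
  rewrite Nat.log2_double by lia.
  replace (2 * (length ls + 1) - 1 - length ls)%nat with (S (length ls)) by lia.
  replace (2 * (length ls + 1) - 1)%nat with (2 * S (length ls) - 1)%nat by lia.
  rewrite Hl. nia.
Qed.

Lemma phi_singletons (l : list cpoint) v :
  (phi v (map (fun p => [p]) l) <= length l * Nat.log2 v)%nat.
Proof.
  revert v; induction l as [|p l IH]; intro v; cbn [map phi length]; [lia |].
  specialize (IH (v - 1)%nat).
  pose proof (Nat.log2_le_mono (v - 1) v ltac:(lia)). nia.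
Qed.

(** [phi] pays for time and space at once. A merge producing [l] takes about [20 * length l] steps
    and [1 + 2 * length l] cells, while [phi] drops by [length l] and [k] by one. The zeros behind
    the result are kept for the colour counters and for the cell of the zero threshold. *)
Lemma merge_sort_spec m a P :
  let n := length P in
  (1 <= n)%nat -> (64 <= a)%nat ->
  m rzero = 0 -> m rone = 1 -> m rn = INR n -> m rh = INR a -> m ro = INR (a + 3 * n) ->
  runs_at m a (map (fun p => [p]) P) -> (forall y, (a + 3 * n <= y)%nat -> m y = 0) ->
  tri merge_sort m (20 * (n * Nat.log2 (2 * n)) + 40 * n + 4) (fun m' => exists b l,
    StronglySorted ple l /\ Permutation l P /\ (64 <= b)%nat /\
    (b + 2 * n <= a + 2 * (n * Nat.log2 (2 * n)) + 4 * n)%nat /\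
    m' rzero = 0 /\ m' rone = 1 /\ m' rn = INR n /\ m' reps = m reps /\
    m' rh = INR b /\ m' ro = INR (b + 1 + 2 * n) /\ pts m' (b + 1) l /\
    (forall y, (b + 1 + 2 * n <= y)%nat -> m' y = 0)).
Proof.
  intros n Hn Ha Hz H1 Hrn Hh Ho Hr Hfree. unfold merge_sort.
  set (ph := phi (2 * n - 1) (map (fun p => [p]) P)).
  assert (Hph : (ph <= n * Nat.log2 (2 * n))%nat).
  { unfold ph. eapply Nat.le_trans; [apply phi_singletons |]. fold n.
    pose proof (Nat.log2_le_mono (2 * n - 1) (2 * n) ltac:(lia)). nia. }
  replace (20 * (n * Nat.log2 (2 * n)) + 40 * n + 4)%nat
    with (S (20 * (n * Nat.log2 (2 * n)) + 40 * n + 3)) by lia.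
  stp.
  set (Inv := fun (v : nat) (m' : mem) => exists ls b k,
    v = (20 * phi (2 * length ls - 1) ls + 40 * k + 2)%nat /\
    length ls = S k /\ (64 <= b)%nat /\
    (b + qsize ls + 2 * phi (2 * length ls - 1) ls + k <= a + 3 * n + 2 * ph + n)%nat /\
    Forall (StronglySorted ple) ls /\ Permutation (concat ls) P /\
    m' rzero = 0 /\ m' rone = 1 /\ m' rn = INR n /\ m' reps = m reps /\ m' rk = INR k /\
    m' rh = INR b /\ m' ro = INR (b + qsize ls) /\ runs_at m' b ls /\
    (forall y, (b + qsize ls <= y)%nat -> m' y = 0)).
  eapply tri_conseq;
    [apply tri_while with (Inv := Inv) (v := (20 * ph + 40 * (n - 1) + 2)%nat)
    | lia | intros m' H; exact H].
  - intros v m' (ls & b & k & -> & Hlen & Hb & Hsp & Hs & Hp & Rz & R1 & Rn & Re & Rk & Rh & Ro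
                 & Hruns & Hf) Hc.
    rewrite Rz, Rk in Hc. change 0 with (INR 0) in Hc. apply INR_lt in Hc.
    destruct ls as [|l1 [|l2 ls]]; [simpl in Hlen; lia | simpl in Hlen; lia |].
    cbn [runs_at] in Hruns. destruct Hruns as (Q1 & P1 & Q2 & P2 & Q3).
    rewrite !qsize_cons in *.
    set (o := (b + (1 + 2 * length l1 + (1 + 2 * length l2 + qsize ls)))%nat) in *.
    exists (11 + (20 * (length l1 + length l2) + 4))%nat.
    ldk b. stp. stp. stp. ldk (b + 1 + 2 * length l1)%nat. do 4 stp. stk o. stp.
    inversion_clear Hs as [|? ? S1 Hs']. inversion_clear Hs' as [|? ? S2 Hs].
    eapply tri_seq with (T2 := 2%nat);
      [eapply merge_loop_spec with (i := (b + 1)%nat) (l1 := l1) (l2 := l2)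
        (j := (b + 1 + 2 * length l1 + 1)%nat) (o := (o + 1)%nat) | | lia];
      rds; auto; try lia; try inr.
    + eapply pts_frame; [exact P1 |]. intros y Hy. rds. auto.
    + eapply pts_frame; [exact P2 |]. intros y Hy. rds. auto.
    + intros m1 (l & Sl & Pl & Ql & Mo & Fr).
      assert (Ll : length l = (length l1 + length l2)%nat)
        by (rewrite (Permutation_length Pl), length_app; auto).
      assert (E12 : m1 rje = INR (b + 1 + 2 * length l1 + 1 + 2 * length l2))
        by (rewrite Fr by lia; rds; inr).
      assert (E2 : m1 rzero = 0) by (rewrite Fr by lia; rds; auto).
      assert (E3 : m1 rone = 1) by (rewrite Fr by lia; rds; auto).
      assert (E8 : m1 rk = INR k) by (rewrite Fr by lia; rds; auto).
      stp. stp. stp. apply tri_skip.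
      exists (20 * phi (2 * length (ls ++ [l]) - 1) (ls ++ [l]) + 40 * (k - 1) + 2)%nat.
      pose proof (phi_merge l1 l2 ls l Ll) as Hphi.
      assert (Hq : qsize (ls ++ [l]) = (qsize ls + 1 + 2 * length l)%nat)
        by (rewrite qsize_app, qsize_cons; unfold qsize; simpl; lia).
      split; [| rewrite Hphi; lia].
      exists (ls ++ [l]), (b + 1 + 2 * length l1 + 1 + 2 * length l2)%nat, (k - 1)%nat.
      rewrite Hphi in Hsp.
      repeat match goal with |- _ /\ _ => split end; rds; auto; try lia; try inr.
      * rewrite length_app. simpl in *; lia.
      * apply Forall_app; auto.
      * rewrite concat_app. simpl. rewrite app_nil_r.
        eapply Permutation_trans; [apply Permutation_app_comm |].
        eapply Permutation_trans; [apply Permutation_app; [exact Pl | reflexivity] |].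
        rewrite <- app_assoc. exact Hp.
      * rewrite Fr by lia. rds; auto.
      * rewrite Fr by lia. rds; auto.
      * rewrite Mo, Hq. unfold o. f_equal; lia.
      * apply runs_at_app. split.
        -- eapply runs_at_frame; [exact Q3 |]. intros y Hy. rds.
           rewrite Fr by lia. rds; auto.
        -- replace (b + 1 + 2 * length l1 + 1 + 2 * length l2 + qsize ls)%nat with o
             by (unfold o; lia).
           cbn [runs_at]. repeat split; auto.
           ++ rds. rewrite Fr by lia. rds. inr.
           ++ eapply pts_frame; [exact Ql |]. intros y Hy. rds. auto.
      * intros y Hy. rewrite Hq in Hy. rds. rewrite Fr by lia. rds. apply Hf. lia.
  - intros v m' (ls & b & k & -> & Hlen & Hb & Hsp & Hs & Hp & Rz & R1 & Rn & Re & Rk & Rh & Ro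
                 & Hruns & Hf) Hc.
    rewrite Rz, Rk in Hc. inr_in Hc. split; [lia |].
    destruct ls as [|l [|? ?]]; try (simpl in Hlen; lia).
    cbn [runs_at] in Hruns. destruct Hruns as (Q1 & Q2 & _).
    simpl in Hp. rewrite app_nil_r in Hp.
    assert (Ll : length l = n) by (apply Permutation_length; auto).
    inversion_clear Hs as [|? ? Sl _].
    rewrite !qsize_cons in *. change (qsize []) with 0%nat in *. rewrite Ll in *.
    exists b, l. repeat split; auto; try lia.
    + rewrite Ro. f_equal; lia.
    + intros; apply Hf; lia.
  - exists (map (fun p => [p]) P), a, (n - 1)%nat.
    rewrite length_map. fold n. fold ph. rewrite qsize_singletons. fold n.
    repeat match goal with |- _ /\ _ => split end; rds; auto; try lia; try inr.
    + apply Forall_forall. intros x Hx. apply in_map_iff in Hx as (p & <- & _).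
      repeat constructor.
    + clear. induction P; simpl; auto.
    + eapply runs_at_frame; [exact Hr |]. intros y Hy. rds. auto.
    + intros y Hy. rds. auto.
Qed.

(** * Entropy *)

(** The factor [INR k] yields the convention 0 log 0 = 0, whatever [log2 0] is. *)
Definition xlx (k : nat) : R := INR k * log2 (INR k).

Definition dxlx (k : nat) : R := xlx (S k) - xlx k.

(** For [g 0 = 0] this is the sum of [g] of the colour counts, see [sum_colors]. Written as a sum of
    increments, it follows the way a sweep changes its window: one point alters one difference, and
    no set of colours is needed. *)
Fixpoint telescope (g : nat -> R) (Q : list cpoint) : R :=
  match Q with
  | [] => 0
  | p :: Q' => telescope g Q' + (g (S (ccount Q' (snd p))) - g (ccount Q' (snd p)))
  end.

Definition scaled_entropy (Q : list cpoint) : R := xlx (length Q) - telescope xlx Q.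

(** * Logarithms and the convexity of x log x *)

Lemma ln2_bounds : / 2 <= ln 2 <= 1.
Proof.
  split.
  - destruct (Rle_lt_dec (/ 2) (ln 2)) as [H | H]; auto. exfalso.
    pose proof (exp_ineq1 (- ln 2)) as E. rewrite exp_Ropp, exp_ln in E by lra.
    assert (- ln 2 <> 0) by (pose proof (ln_increasing 1 2); rewrite ln_1 in *; lra).
    specialize (E H0). lra.
  - pose proof (exp_ineq1 1 ltac:(lra)) as E.
    apply Rlt_le. replace 1 with (ln (exp 1)) by apply ln_exp. apply ln_increasing; lra.
Qed.

(** This is [exp y >= 1 + y] at [y = - ln x]. *)
Lemma ln_ge_1_inv x : 0 < x -> 1 - / x <= ln x.
Proof.
  intro Hx. destruct (Req_dec (ln x) 0) as [E | E].
  - assert (x = 1) as -> by (apply ln_inv; try lra; rewrite ln_1; auto).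
    rewrite ln_1; lra.
  - pose proof (exp_ineq1 (- ln x) ltac:(lra)) as H.
    rewrite exp_Ropp, exp_ln in H by auto. lra.
Qed.

Lemma ln_div x y : 0 < x -> 0 < y -> ln (x / y) = ln x - ln y.
Proof.
  intros; unfold Rdiv; rewrite ln_mult, ln_Rinv by auto with real; ring.
Qed.

Lemma log2_mult x y : 0 < x -> 0 < y -> log2 (x * y) = log2 x + log2 y.
Proof. intros; unfold log2; rewrite ln_mult by auto; pose proof ln2_bounds; field; lra. Qed.

Lemma log2_div x y : 0 < x -> 0 < y -> log2 (x / y) = log2 x - log2 y.
Proof.
  intros; unfold log2; rewrite ln_div by auto; pose proof ln2_bounds; field; lra.
Qed.

Lemma log2_le x y : 0 < x -> x <= y -> log2 x <= log2 y.
Proof.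
  intros; unfold log2; apply Rmult_le_compat_r.
  - left; apply Rinv_0_lt_compat; pose proof ln2_bounds; lra.
  - destruct (Req_dec x y) as [-> | Hne]; [lra |]. left; apply ln_increasing; lra.
Qed.

Lemma log2_1 : log2 1 = 0.
Proof. unfold log2; rewrite ln_1; unfold Rdiv; ring. Qed.

Lemma log2_2 : log2 2 = 1.
Proof. unfold log2; pose proof ln2_bounds; field; lra. Qed.

Lemma log2_pow x k : 0 < x -> log2 (x ^ k) = INR k * log2 x.
Proof.
  intro Hx; induction k as [|k IH].
  - simpl. rewrite log2_1; ring.
  - rewrite <- tech_pow_Rmult, S_INR, log2_mult, IH; auto; [ring | apply pow_lt; auto].
Qed.

Lemma xlx_0 : xlx 0 = 0.
Proof. unfold xlx; simpl; ring. Qed.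

Lemma xlx_1 : xlx 1 = 0.
Proof. unfold xlx; simpl; rewrite log2_1; ring. Qed.

Lemma xlx_2 : xlx 2 = 2.
Proof. unfold xlx; simpl; replace (1 + 1) with 2 by ring; rewrite log2_2; ring. Qed.

(* Convexity of x log x, from [ln y >= 1 - 1/y] at [y = (k+2)/(k+1)] and [y = k/(k+1)]. *)
Lemma dxlx_S k : dxlx k <= dxlx (S k).
Proof.
  unfold dxlx. destruct k as [|k].
  - rewrite xlx_0, xlx_1, xlx_2; lra.
  - unfold xlx, log2. set (a := INR (S k)).
    assert (Ha : 0 < a) by (apply lt_0_INR; lia).
    replace (INR (S (S k))) with (a + 1) by (unfold a; rewrite (S_INR (S k)); auto).
    replace (INR (S (S (S k)))) with (a + 2)
      by (unfold a; rewrite (S_INR (S (S k))), (S_INR (S k)); ring).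
    assert (H1 : 1 - / ((a + 2) / (a + 1)) <= ln ((a + 2) / (a + 1)))
      by (apply ln_ge_1_inv; apply Rdiv_lt_0_compat; lra).
    assert (H2 : 1 - / (a / (a + 1)) <= ln (a / (a + 1)))
      by (apply ln_ge_1_inv; apply Rdiv_lt_0_compat; lra).
    rewrite ln_div in H1, H2 by lra.
    apply (Rmult_le_compat_l (a + 2)) in H1; [| lra].
    apply (Rmult_le_compat_l a) in H2; [| lra].
    replace ((a + 2) * (1 - / ((a + 2) / (a + 1)))) with 1 in H1 by (field; lra).
    replace (a * (1 - / (a / (a + 1)))) with (-1) in H2 by (field; lra).
    assert (H : 0 <= ((a + 2) * ln (a + 2) - (a + 1) * ln (a + 1)) - ((a + 1) * ln (a + 1) - a * ln a))
      by lra.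
    apply (Rmult_le_compat_r (/ ln 2)) in H;
      [| left; apply Rinv_0_lt_compat; pose proof ln2_bounds; lra].
    unfold Rdiv. lra.
Qed.

Lemma dxlx_le i j : (i <= j)%nat -> dxlx i <= dxlx j.
Proof.
  induction 1; [lra |]. eapply Rle_trans; [eassumption | apply dxlx_S].
Qed.

(** * Colour counts and the scaled entropy *)

Lemma ccount_cons p Q c :
  ccount (p :: Q) c = ((if Nat.eqb (snd p) c then 1 else 0) + ccount Q c)%nat.
Proof. unfold ccount; simpl; destruct (Nat.eqb (snd p) c); auto. Qed.

Lemma ccount_app Q1 Q2 c : ccount (Q1 ++ Q2) c = (ccount Q1 c + ccount Q2 c)%nat.
Proof. unfold ccount; rewrite filter_app, length_app; auto. Qed.

Lemma ccount_le Q c : (ccount Q c <= length Q)%nat.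
Proof. unfold ccount; apply filter_length_le. Qed.

Lemma ccount_perm Q Q' c : Permutation Q Q' -> ccount Q c = ccount Q' c.
Proof.
  induction 1; rewrite ?ccount_cons; lia.
Qed.

Lemma ccount_pos Q c : In c (map snd Q) <-> (0 < ccount Q c)%nat.
Proof.
  induction Q as [|p Q IH]; [cbn; lia |].
  rewrite ccount_cons. simpl. rewrite IH.
  destruct (Nat.eqb_spec (snd p) c); lia.
Qed.

(** Exchanging two neighbours of one colour exchanges equal increments, and neighbours of different
    colours do not affect each other. This allows points to be added at either end of a window and
    the input to be replaced by its sorted version. *)
Lemma telescope_perm g Q Q' : Permutation Q Q' -> telescope g Q = telescope g Q'.
Proof.
  induction 1 as [| p Q Q' HP IH | p q Q | Q1 Q2 Q3 _ IH1 _ IH2]; simpl; auto.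
  - rewrite IH, (ccount_perm Q Q'); auto.
  - rewrite !ccount_cons. rewrite (Nat.eqb_sym (snd q) (snd p)).
    destruct (Nat.eqb_spec (snd p) (snd q)) as [-> | _]; simpl; ring.
  - congruence.
Qed.

Lemma telescope_snoc Q p g :
  telescope g (Q ++ [p]) = telescope g Q + (g (S (ccount Q (snd p))) - g (ccount Q (snd p))).
Proof.
  rewrite (telescope_perm g (Q ++ [p]) (p :: Q)); auto.
  apply Permutation_sym, Permutation_cons_append.
Qed.

Lemma telescope_INR Q : telescope INR Q = INR (length Q).
Proof.
  induction Q as [|p Q IH]; cbn [telescope]; auto.
  change (length (p :: Q)) with (S (length Q)). rewrite IH, !S_INR; ring.
Qed.

Lemma sum_update (f f' : nat -> R) D c0 :
  NoDup D -> In c0 D -> (forall c, c <> c0 -> f c = f' c) ->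
  fold_right Rplus 0 (map f D) = fold_right Rplus 0 (map f' D) + (f c0 - f' c0).
Proof.
  intros HD Hin Hf. induction HD as [|x D Hx HD IH]; [destruct Hin |]; simpl.
  destruct (Nat.eq_dec x c0) as [-> | Hne].
  - rewrite (map_ext_in f f') by (intros c Hc; apply Hf; congruence). ring.
  - rewrite IH by (destruct Hin; congruence). rewrite Hf by auto. ring.
Qed.

(** A new point changes the term of its own colour only; if the colour is new, its previous term
    counts as [g 0 = 0]. *)
Lemma sum_colors (g : nat -> R) Q : g 0%nat = 0 ->
  fold_right Rplus 0 (map (fun c => g (ccount Q c)) (colors Q)) = telescope g Q.
Proof.
  intro Hg. induction Q as [|p Q IH]; auto.
  cbn [telescope]. rewrite <- IH. unfold colors. simpl nodup.
  assert (E : ccount (p :: Q) (snd p) = S (ccount Q (snd p)))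
    by (rewrite ccount_cons, Nat.eqb_refl; auto).
  assert (Hne : forall c, c <> snd p -> g (ccount (p :: Q) c) = g (ccount Q c)).
  { intros c Hc. rewrite ccount_cons. destruct (Nat.eqb_spec (snd p) c); auto; congruence. }
  destruct (in_dec Nat.eq_dec (snd p) (map snd Q)) as [Hin | Hin].
  - rewrite (sum_update _ (fun c => g (ccount Q c)) _ (snd p)); auto.
    + rewrite E; auto.
    + apply NoDup_nodup.
    + apply nodup_In; auto.
  - simpl. rewrite E.
    assert (Hz : ccount Q (snd p) = 0%nat).
    { destruct (ccount Q (snd p)) eqn:Ec; auto. exfalso; apply Hin, ccount_pos; lia. }
    rewrite Hz, Hg.
    rewrite (map_ext_in _ (fun c => g (ccount Q c))); [ring |].
    intros c Hc. apply Hne. intros ->. apply nodup_In in Hc. auto.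
Qed.

Lemma fold_right_scal (f : nat -> R) a D :
  fold_right Rplus 0 (map (fun c => a * f c) D) = a * fold_right Rplus 0 (map f D).
Proof. induction D as [|x D IH]; simpl; [ring | rewrite IH; ring]. Qed.

Lemma fold_right_minus (f g : nat -> R) D :
  fold_right Rplus 0 (map (fun c => f c - g c) D) =
  fold_right Rplus 0 (map f D) - fold_right Rplus 0 (map g D).
Proof. induction D as [|x D IH]; simpl; [ring | rewrite IH; ring]. Qed.

(** A term [k/N log (N/k)] equals [(k log N - k log k) / N], and the counts [k] sum to [N] by
    [telescope_INR]. *)
Lemma entropy_scaled Q : (0 < length Q)%nat -> entropy Q = scaled_entropy Q / INR (length Q).
Proof.
  intro HQ. unfold entropy, scaled_entropy. cbv zeta.
  set (N := INR (length Q)). assert (HN : 0 < N) by (apply lt_0_INR; auto).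
  rewrite (map_ext_in _ (fun c => / N * (log2 N * INR (ccount Q c) - xlx (ccount Q c)))).
  - rewrite fold_right_scal, fold_right_minus, fold_right_scal.
    rewrite (sum_colors INR), (sum_colors xlx), telescope_INR; auto using xlx_0.
    unfold xlx at 2. fold N. field; lra.
  - intros c Hc. apply nodup_In, ccount_pos, lt_0_INR in Hc.
    rewrite log2_div by auto. unfold xlx. field; lra.
Qed.

Lemma scaled_entropy_cons p Q :
  scaled_entropy (p :: Q) =
  scaled_entropy Q + (dxlx (length Q) - dxlx (ccount Q (snd p))).
Proof. unfold scaled_entropy, dxlx; cbn [telescope length]; ring. Qed.

Lemma scaled_entropy_perm Q Q' : Permutation Q Q' -> scaled_entropy Q = scaled_entropy Q'.
Proof.
  intro H; unfold scaled_entropy.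
  rewrite (telescope_perm _ _ _ H), (Permutation_length H); auto.
Qed.

Lemma scaled_entropy_cons_le p Q : scaled_entropy Q <= scaled_entropy (p :: Q).
Proof.
  rewrite scaled_entropy_cons. pose proof (dxlx_le _ _ (ccount_le Q (snd p))). lra.
Qed.

Lemma scaled_entropy_snoc_le p Q : scaled_entropy Q <= scaled_entropy (Q ++ [p]).
Proof.
  rewrite (scaled_entropy_perm (Q ++ [p]) (p :: Q)); [apply scaled_entropy_cons_le |].
  apply Permutation_sym, Permutation_cons_append.
Qed.

Lemma scaled_entropy_nil : scaled_entropy [] = 0.
Proof. unfold scaled_entropy; simpl; rewrite xlx_0; ring. Qed.

(** The induction must remember that value 0 comes with at most one colour. The first point of a
    second colour then adds [dxlx N - dxlx 0 >= dxlx 1 = 2], and monotonicity preserves the bound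
    afterwards. *)
Lemma scaled_entropy_gap Q : scaled_entropy Q = 0 \/ 1 <= scaled_entropy Q.
Proof.
  cut ((scaled_entropy Q = 0 /\ (Q = [] \/ exists c, forall c', ccount Q c' = if Nat.eqb c c' then length Q else 0%nat))
       \/ 1 <= scaled_entropy Q); [tauto |].
  induction Q as [|p Q [[E [-> | (c & Hc)]] | H]].
  - left; split; [apply scaled_entropy_nil | auto].
  - left; split.
    + rewrite scaled_entropy_cons, scaled_entropy_nil; cbn [length ccount filter map]; ring.
    + right. exists (snd p). intro c'. rewrite ccount_cons. destruct (Nat.eqb (snd p) c'); auto.
  - destruct (Nat.eqb_spec c (snd p)) as [-> | Hne].
    + left. split.
      * rewrite scaled_entropy_cons, Hc, Nat.eqb_refl, E; ring.
      * right. exists (snd p). intro c'. rewrite ccount_cons, Hc.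
        destruct (Nat.eqb (snd p) c'); auto.
    + destruct Q as [|q Q].
      * left; split; [rewrite scaled_entropy_cons, scaled_entropy_nil; cbn [length ccount filter map]; ring |].
        right. exists (snd p). intro c'. rewrite ccount_cons. destruct (Nat.eqb (snd p) c'); auto.
      * right. rewrite scaled_entropy_cons, E, Hc.
        destruct (Nat.eqb_spec c (snd p)); [congruence |].
        pose proof (dxlx_le 1 (length (q :: Q)) ltac:(simpl; lia)) as H1.
        unfold dxlx in H1 at 1. unfold dxlx at 2. rewrite xlx_0, xlx_1, xlx_2 in *. lra.
  - right. pose proof (scaled_entropy_cons_le p Q). lra.
Qed.

(** From [ln a <= a] and [ln 2 >= 1/2]; a quadratic bound is good enough, as only its logarithm
    matters. *)
Lemma xlx_le k : xlx k <= 2 * INR k * INR k.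
Proof.
  destruct k as [|k]; [rewrite xlx_0; simpl; lra |]. unfold xlx, log2.
  set (a := INR (S k)). assert (Ha : 1 <= a) by (apply (le_INR 1); lia).
  assert (H : ln a <= a).
  { pose proof (exp_ineq1_le (ln a)) as E. rewrite exp_ln in E by lra. lra. }
  assert (H2 : ln a / ln 2 <= 2 * a); [| nra].
  pose proof ln2_bounds as [B _]. apply Rmult_le_reg_r with (ln 2); [lra |].
  unfold Rdiv. rewrite Rmult_assoc, Rinv_l by lra. nra.
Qed.

Lemma telescope_xlx_ge0 Q : 0 <= telescope xlx Q.
Proof.
  induction Q as [|p Q IH]; cbn [telescope]; [lra |].
  pose proof (dxlx_le 0 (ccount Q (snd p)) ltac:(lia)) as H.
  unfold dxlx in H. rewrite xlx_0, xlx_1 in H. lra.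
Qed.

Lemma scaled_entropy_le Q n : (length Q <= n)%nat -> scaled_entropy Q <= 2 * INR n * INR n.
Proof.
  intro H. unfold scaled_entropy.
  pose proof (telescope_xlx_ge0 Q). pose proof (xlx_le (length Q)).
  apply le_INR in H. pose proof (pos_INR (length Q)). nra.
Qed.

(** * Windows of a list *)

Definition slice {A} (i j : nat) (l : list A) : list A := firstn (j - i) (skipn i l).

Lemma slice_snoc {A} i j (l : list A) d : (i <= j < length l)%nat ->
  slice i (S j) l = slice i j l ++ [nth j l d].
Proof.
  revert i j; induction l as [|x l IH]; intros i j [Hij Hj]; simpl in Hj; [lia |].
  unfold slice in *. destruct i as [|i].
  - destruct j as [|j]; auto. specialize (IH 0%nat j ltac:(lia)).
    cbn [skipn firstn Nat.sub nth app] in *. rewrite Nat.sub_0_r in IH. rewrite IH. reflexivity.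
  - destruct j as [|j]; [lia |]. specialize (IH i j ltac:(lia)).
    cbn [skipn Nat.sub nth] in *. rewrite IH; reflexivity.
Qed.

Lemma slice_cons {A} i j (l : list A) d : (i < j)%nat -> (i < length l)%nat ->
  slice i j l = nth i l d :: slice (S i) j l.
Proof.
  revert i j; induction l as [|x l IH]; intros i j Hij Hi; simpl in Hi; [lia |].
  unfold slice in *. destruct i as [|i].
  - destruct j as [|j]; [lia |]. cbn. rewrite Nat.sub_0_r; reflexivity.
  - destruct j as [|j]; [lia |]. specialize (IH i j ltac:(lia) ltac:(lia)).
    cbn [skipn Nat.sub nth] in *. exact IH.
Qed.

Lemma slice_nil {A} i j (l : list A) : (j <= i)%nat -> slice i j l = [].
Proof. intro H; unfold slice; replace (j - i)%nat with 0%nat by lia; reflexivity. Qed.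

Lemma length_slice {A} i j (l : list A) : (j <= length l)%nat -> length (slice i j l) = (j - i)%nat.
Proof. intro; unfold slice; rewrite length_firstn, length_skipn; lia. Qed.

Lemma scaled_entropy_slice_r i j j' l : (j <= j' <= length l)%nat ->
  scaled_entropy (slice i j l) <= scaled_entropy (slice i j' l).
Proof.
  intros [H H']. induction H as [|j' H IH]; [lra |].
  eapply Rle_trans; [apply IH; lia |].
  destruct (le_lt_dec i j').
  - rewrite (slice_snoc i j' l (0, 0%nat)) by lia. apply scaled_entropy_snoc_le.
  - rewrite !slice_nil by lia. lra.
Qed.

Lemma scaled_entropy_slice_l i j l : (i < length l)%nat ->
  scaled_entropy (slice (S i) j l) <= scaled_entropy (slice i j l).
Proof.
  intro H. destruct (le_lt_dec j i).
  - rewrite !slice_nil by lia. lra.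
  - rewrite (slice_cons i j l (0, 0%nat)) by lia. apply scaled_entropy_cons_le.
Qed.

Lemma filter_slice {A} (f : A -> bool) d l : forall i e,
  (forall t, (t < length l)%nat -> f (nth t l d) = true <-> (i <= t < e)%nat) ->
  filter f l = slice i e l.
Proof.
  induction l as [|x l IH]; intros i e H.
  - unfold slice. rewrite skipn_nil, firstn_nil. reflexivity.
  - assert (H0 := H 0%nat ltac:(simpl; lia)). simpl in H0.
    assert (HS : forall t, (t < length l)%nat -> f (nth t l d) = true <-> (i <= S t < e)%nat)
      by (intros t Ht; apply (H (S t)); simpl; lia).
    simpl. destruct (f x); destruct i as [|i].
    + destruct e as [|e]; [lia |]. unfold slice. cbn [skipn Nat.sub firstn]. f_equal.
      rewrite (IH 0%nat e); [unfold slice; rewrite Nat.sub_0_r; reflexivity |].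
      intros t Ht. rewrite HS by auto. lia.
    + lia.
    + destruct e as [|e]; [| exfalso; destruct H0 as [_ H0]; specialize (H0 ltac:(lia)); discriminate].
      rewrite (IH 0%nat 0%nat); [reflexivity |]. intros t Ht. rewrite HS by auto. lia.
    (* The truncated [e - 1] also covers [e = 0], where both windows are empty. *)
    + rewrite (IH i (e - 1)%nat).
      * unfold slice. cbn [skipn]. f_equal. lia.
      * intros t Ht. rewrite HS by auto. lia.
Qed.

Lemma Permutation_filter' {A} (f : A -> bool) l l' :
  Permutation l l' -> Permutation (filter f l) (filter f l').
Proof.
  induction 1; simpl; auto.
  - destruct (f x); auto.
  - destruct (f x), (f y); auto. apply perm_swap.
  - eapply Permutation_trans; eauto.
Qed.

(** * The threshold tables *)

Notation rL := 16%nat (only parsing).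
Notation rw := 17%nat (only parsing).
Notation rT := 18%nat (only parsing).
Notation re1 := 19%nat (only parsing).
Notation rjp := 20%nat (only parsing).
Notation rE := 21%nat (only parsing).
Notation rpi := 22%nat (only parsing).
Notation rpj := 23%nat (only parsing).
Notation rN := 24%nat (only parsing).
Notation rS := 25%nat (only parsing).
Notation rgain := 26%nat (only parsing).
Notation rmone := 27%nat (only parsing).
Notation rtwo := 28%nat (only parsing).
Notation rwt := 29%nat (only parsing).
Notation rjb := 30%nat (only parsing).
Notation rsb := 31%nat (only parsing).
Notation rn1 := 32%nat (only parsing).
Notation rq := 33%nat (only parsing).

(** [ro] is advanced before the first store, so cell [wt] keeps its 0 and serves as the value below
    the first threshold; cell [wt + t] receives the [t]-th power. *)
Definition powers : cmd :=
  Do (IAdd rwt ro rzero) ;; Do (IAdd rx rn rn) ;; Do (IMul rT rx rn) ;;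
  Do (IAdd re1 rone reps) ;; Do (IConst rw 1) ;; Do (IConst rL 0) ;;
  WhileLt rw rT
    (Do (IMul rw rw re1) ;; Do (IAdd ro ro rone) ;; Do (IStore ro rw) ;; Do (IAdd rL rL rone)).

(** [Lmax] is any exponent known to reach the cap. It only bounds the running time; the program
    stops at its own [L], because at [L = Lmax] the loop test must fail. *)
Lemma powers_spec m n eps wt Lmax :
  m rzero = 0 -> m rone = 1 -> m rn = INR n -> m reps = eps -> m ro = INR wt -> 0 < eps ->
  (64 <= wt)%nat -> 2 * INR n * INR n <= (1 + eps) ^ Lmax ->
  tri powers m (6 * Lmax + 8) (fun m' => exists L, (L <= Lmax)%nat /\
    2 * INR n * INR n <= (1 + eps) ^ L /\
    m' rL = INR L /\ m' re1 = 1 + eps /\ m' rwt = INR wt /\ m' ro = INR (wt + L) /\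
    (forall t, (1 <= t <= L)%nat -> m' (wt + t)%nat = (1 + eps) ^ t) /\
    (forall y, (y <= wt \/ wt + L < y)%nat -> y <> rwt -> y <> rx -> y <> rT -> y <> re1 ->
       y <> rw -> y <> rL -> y <> ro -> m' y = m y)).
Proof.
  intros Hz H1 Hn He Ho Heps Hwt HT. unfold powers.
  replace (6 * Lmax + 8)%nat with (6 + (6 * Lmax + 2))%nat by lia.
  do 6 stp.
  set (Inv := fun (v : nat) (m' : mem) => exists L, v = (6 * (Lmax - L) + 2)%nat /\
    (L <= Lmax)%nat /\ m' rone = 1 /\ m' rT = 2 * INR n * INR n /\ m' rw = (1 + eps) ^ L /\
    m' rL = INR L /\ m' re1 = 1 + eps /\ m' rwt = INR wt /\ m' ro = INR (wt + L) /\
    (forall t, (1 <= t <= L)%nat -> m' (wt + t)%nat = (1 + eps) ^ t) /\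
    (forall y, (y <= wt \/ wt + L < y)%nat -> y <> rwt -> y <> rx -> y <> rT -> y <> re1 ->
       y <> rw -> y <> rL -> y <> ro -> m' y = m y)).
  eapply tri_conseq;
    [apply tri_while with (Inv := Inv) (v := (6 * (Lmax - 0) + 2)%nat)
    | lia | intros m' H; exact H].
  - intros v m' (L & -> & HL & R1 & RT & Rw & RL & Re1 & Rwt & Ro & HW & Fr) Hc.
    rewrite RT, Rw in Hc.
    assert (HL' : (L < Lmax)%nat).
    { destruct (Nat.eq_dec L Lmax) as [-> | ?]; [lra | lia]. }
    exists 4%nat. do 2 stp. stk (wt + S L)%nat. do 2 stp. apply tri_skip.
    exists (6 * (Lmax - S L) + 2)%nat. split; [| lia].
    exists (S L). repeat match goal with |- _ /\ _ => split end; rds; auto; try lia; try inr.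
    + simpl; ring.
    + intros t Ht. destruct (Nat.eq_dec t (S L)) as [-> | Hne].
      * rds. simpl; ring.
      * rds. apply HW; lia.
    + intros y Hy *. intros. rds. apply Fr; lia.
  - intros v m' (L & -> & HL & R1 & RT & Rw & RL & Re1 & Rwt & Ro & HW & Fr) Hc.
    rewrite RT, Rw in Hc. split; [lia |]. exists L. repeat split; auto; lra.
  - exists 0%nat. repeat match goal with |- _ /\ _ => split end; rds; auto; try lia; try inr.
    + rewrite Ho. f_equal; lia.
    + intros y Hy *. intros. rds. auto.
Qed.

(** The test is required because [ILog2] is stuck at 0. *)
Definition xlog (d s : nat) : cmd :=
  IfLt rzero s (Do (ILog2 d s) ;; Do (IMul d s d)) (Do (IConst d 0)).

Lemma xlog_spec m d s k : d <> s -> m rzero = 0 -> m s = INR k ->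
  tri (xlog d s) m 4 (fun m' => m' d = xlx k /\ forall y, y <> d -> m' y = m y).
Proof.
  intros Hd Hz Hs. unfold xlog. eapply tri_if; [rg | rg | |]; intro Hk.
  - eapply tri_log2; [rg | auto |]. stp. eapply tri_mul; [rg | rg |]. apply tri_skip.
    split; [rds; reflexivity |]. intros; rds; auto.
  - stp. stp. apply tri_skip. change 0 with (INR 0) in Hk. inr_in Hk.
    assert (k = 0%nat) as -> by lia. rewrite xlx_0. split; [rds; reflexivity |]. intros; rds; auto.
Qed.

(** One routine for both ends of the window: [d] is the register holding 1 when a point enters on
    the right, or -1 when one leaves on the left. [rN] is the window size and [rS] the sum of [xlx]
    over its colour counts, corrected by the old and the new term of one colour. *)
Definition bump (ptr d : nat) : cmd :=
  Do (IAdd rx ptr rone) ;; Do (ILoad rx rx) ;; Do (IAdd rx rE rx) ;; Do (ILoad rk rx) ;;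
  xlog ry rk ;; Do (ISub rS rS ry) ;; Do (IAdd rk rk d) ;; xlog ry rk ;; Do (IAdd rS rS ry) ;;
  Do (IStore rx rk) ;; Do (IAdd rN rN d) ;; Do (IAdd ptr ptr rtwo).

Lemma bump_spec m ptr d a c E k k' N N' :
  (ptr = rpi /\ d = rmone) \/ (ptr = rpj /\ d = rone) ->
  m rzero = 0 -> m rone = 1 -> m rtwo = 2 ->
  m ptr = INR a -> m (a + 1)%nat = INR c -> m rE = INR E -> m (E + c)%nat = INR k ->
  m rN = INR N -> INR k + m d = INR k' -> INR N + m d = INR N' -> (64 <= a)%nat -> (64 <= E)%nat ->
  tri (bump ptr d) m 18 (fun m' =>
    m' ptr = INR (a + 2) /\ m' rS = m rS - xlx k + xlx k' /\ m' rN = INR N' /\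
    m' (E + c)%nat = INR k' /\
    forall y, y <> ptr -> y <> rS -> y <> rN -> y <> rx -> y <> ry -> y <> rk ->
      y <> (E + c)%nat -> m' y = m y).
Proof.
  intros Hpd Hz H1 H2 Hp Hc HE Hk HN Hk' HN' Ha HE'. unfold bump.
  assert (Hp' : ptr = 22%nat \/ ptr = 23%nat) by lia.
  assert (Hd' : d = 27%nat \/ d = 3%nat) by lia.
  assert (Hpd' : ptr <> d) by lia.
  stp. ldk (a + 1)%nat. stp. ldk (E + c)%nat.
  eapply tri_seq with (T1 := 4%nat) (T2 := 10%nat);
    [apply xlog_spec with (k := k); [lia | rg | rg] | | lia].
  intros m1 [A B].
  assert (B8 : m1 rk = INR k) by (rewrite B by lia; rds; auto).
  assert (Bd : m1 d = m d) by (rewrite B by lia; rds; auto).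
  assert (BS : m1 rS = m rS) by (rewrite B by lia; rds; auto).
  stp. stp.
  eapply tri_seq with (T1 := 4%nat) (T2 := 4%nat);
    [apply xlog_spec with (k := k'); [lia | rds; rewrite B by lia; rg | rds; auto] | | lia].
  intros m2 [C D].
  assert (D8 : m2 rk = INR k') by (rewrite D by lia; rds; auto).
  assert (D14 : m2 rx = INR (E + c)) by (rewrite D by lia; rds; rewrite B by lia; rds; inr).
  assert (DS : m2 rS = m rS - xlx k) by (rewrite D by lia; rds; reflexivity).
  assert (DN : m2 rN = INR N) by (rewrite D by lia; rds; rewrite B by lia; rds; auto).
  assert (Dd : m2 d = m d) by (rewrite D by lia; rds; auto).
  assert (Dp : m2 ptr = INR a) by (rewrite D by lia; rds; rewrite B by lia; rds; auto).
  assert (D2 : m2 rtwo = 2) by (rewrite D by lia; rds; rewrite B by lia; rds; auto).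
  stp. stk (E + c)%nat. do 3 stp. apply tri_skip.
  repeat match goal with |- _ /\ _ => split end; rds; auto; try inr.
  intros y *. intros. rds. rewrite D by lia. rds. rewrite B by lia. rds; auto.
Qed.

(** Records [rq] as the end belonging to the left end [i] and drops point [i] from the window. [rq]
    holds [j], or [n + 1] once the points have run out. *)
Definition emit : cmd :=
  Do (IStore rjp rq) ;; Do (IAdd rjp rjp rone) ;; bump rpi rmone ;; Do (IAdd ri ri rone).

Definition sweep : cmd :=
  WhileLt ri rn
    (xlog rgain rN ;; Do (ISub rgain rgain rS) ;; Do (IAdd rq rj rzero) ;;
     IfLt rgain rw
       (IfLt rj rn (bump rpj rone ;; Do (IAdd rj rj rone))
                   (Do (IAdd rq rn1 rzero) ;; emit))
       emit).

(* [J] exceeds [length l] when no window starting at [t] reaches [w]. *)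
Definition first_end (l : list cpoint) (w : R) (t J : nat) : Prop :=
  forall e, (e <= length l)%nat -> (J <= e)%nat <-> w <= scaled_entropy (slice t e l).

(** Excluded are the working registers, the [i] table entries already written, and all cells from
    [E] on, which belong to the counters. *)
Definition sweep_frame (jp i E : nat) (m m' : mem) : Prop :=
  forall y, (y < 8 \/ 15 < y < 20 \/ y = 21 \/ 26 < y < 33 \/ 33 < y < jp \/ jp + i <= y < E)%nat ->
    m' y = m y.

(** Every round advances [i] or [j], hence at most [2 n] rounds. Both end at [n] with an empty
    window, so the counters are 0 again and the next threshold needs no clearing pass. *)
Lemma sweep_spec m l w sb jp E :
  let n := length l in
  m rzero = 0 -> m rone = 1 -> m rn = INR n -> m rtwo = 2 -> m rmone = -1 ->
  m rn1 = INR (n + 1) -> m rw = w -> m rE = INR E -> m rjp = INR jp ->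
  m ri = 0 -> m rj = 0 -> m rpi = INR sb -> m rpj = INR sb -> m rN = 0 -> m rS = 0 ->
  pts m sb l -> (forall c, m (E + c)%nat = 0) -> 1 <= w ->
  (64 <= sb)%nat -> (sb + 2 * n <= jp)%nat -> (jp + n <= E)%nat ->
  tri sweep m (50 * (2 * n) + 2) (fun m' =>
    m' rN = 0 /\ m' rS = 0 /\ m' rjp = INR (jp + n) /\
    (forall c, m' (E + c)%nat = 0) /\ sweep_frame jp n E m m' /\
    (forall t, (t < n)%nat -> exists J, m' (jp + t)%nat = INR J /\ first_end l w t J)).
Proof.
  intros n Hz H1 Hn H2 Hm1 Hn1 Hw HE Hjp Hi Hj Hpi Hpj HN HS Hpts Hcnt Hw1 Bsb Bjp BE.
  unfold sweep.
  (* All ends before [j] fall short of [w]. This survives a step of [i], since shrinking a window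
     lowers its scaled entropy; so the first [j] that reaches [w] is the wanted end and [j] never
     moves back. *)
  set (Inv := fun (v : nat) (m' : mem) => exists i j,
    v = (50 * ((n - i) + (n - j)) + 2)%nat /\ (i <= j <= n)%nat /\
    m' ri = INR i /\ m' rj = INR j /\ m' rpi = INR (sb + 2 * i) /\ m' rpj = INR (sb + 2 * j) /\
    m' rN = INR (j - i) /\ m' rS = telescope xlx (slice i j l) /\ m' rjp = INR (jp + i) /\
    (forall c, m' (E + c)%nat = INR (ccount (slice i j l) c)) /\
    (forall e, (e < j)%nat -> scaled_entropy (slice i e l) < w) /\
    (forall t, (t < i)%nat -> exists J, m' (jp + t)%nat = INR J /\ first_end l w t J) /\
    sweep_frame jp i E m m').
  eapply tri_conseq;
    [apply tri_while with (Inv := Inv) (v := (50 * ((n - 0) + (n - 0)) + 2)%nat)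
    | lia | intros m' H; exact H].
  - intros v m' (i & j & -> & Hij & Ri & Rj & Rpi & Rpj & RN & RS & Rjp & Cn & Lt & HJ & Fr) Hc.
    assert (Rn : m' rn = INR n) by (rewrite Fr by lia; auto).
    assert (Rz : m' rzero = 0) by (rewrite Fr by lia; auto).
    rewrite Ri, Rn in Hc. apply INR_lt in Hc.
    exists 40%nat.
    eapply tri_seq with (T1 := 4%nat) (T2 := 36%nat);
      [apply xlog_spec with (k := (j - i)%nat); [lia | rg | rg] | | lia].
    intros m1 [A B].
    assert (Eg : xlx (j - i) - telescope xlx (slice i j l) = scaled_entropy (slice i j l))
      by (unfold scaled_entropy; rewrite length_slice by (fold n; lia); auto).
    assert (BS : m1 rS = telescope xlx (slice i j l)) by (rewrite B by lia; auto).
    assert (Bj : m1 rj = INR j) by (rewrite B by lia; auto).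
    assert (Bz : m1 rzero = 0) by (rewrite B by lia; auto).
    stp. setv (scaled_entropy (slice i j l)). stp.
    set (m2 := upd (upd m1 26 (scaled_entropy (slice i j l))) 33 (INR j + 0)).
    assert (F2 : forall y, y <> 26%nat -> y <> 33%nat -> m2 y = m' y)
      by (intros; unfold m2; rds; apply B; lia).
    assert (G2 : m2 rgain = scaled_entropy (slice i j l)) by (unfold m2; rds; auto).
    assert (q2 : m2 rq = INR j) by (unfold m2; rds; ring).
    clearbody m2.
    assert (m2 rw = w) by (rewrite F2, Fr by lia; auto).
    assert (m2 rn = INR n) by (rewrite F2 by lia; auto).
    assert (m2 rj = INR j) by (rewrite F2 by lia; auto).
    assert (m2 rn1 = INR (n + 1)) by (rewrite F2, Fr by lia; auto).
    assert (m2 rzero = 0) by (rewrite F2 by lia; auto).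
    assert (Mo : m2 rone = 1) by (rewrite F2, Fr by lia; auto).
    assert (m2 rtwo = 2) by (rewrite F2, Fr by lia; auto).
    assert (Mm : m2 rmone = -1) by (rewrite F2, Fr by lia; auto).
    assert (m2 rE = INR E) by (rewrite F2, Fr by lia; auto).
    assert (m2 rjp = INR (jp + i)) by (rewrite F2 by lia; auto).
    assert (m2 rpi = INR (sb + 2 * i)) by (rewrite F2 by lia; auto).
    assert (m2 rpj = INR (sb + 2 * j)) by (rewrite F2 by lia; auto).
    assert (m2 ri = INR i) by (rewrite F2 by lia; auto).
    assert (m2 rN = INR (j - i)) by (rewrite F2 by lia; auto).
    assert (MS : m2 rS = telescope xlx (slice i j l)) by (rewrite F2 by lia; auto).
    assert (Cn2 : forall c, m2 (E + c)%nat = INR (ccount (slice i j l) c))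
      by (intro; rewrite F2 by lia; auto).
    assert (HJ2 : forall t, (t < i)%nat -> exists J, m2 (jp + t)%nat = INR J /\ first_end l w t J).
    { intros t Ht. destruct (HJ t Ht) as (J & HJ1 & HJ'). exists J. split; auto.
      rewrite F2 by lia; auto. }
    assert (Fr2 : sweep_frame jp i E m m2) by (intros y Hy; rewrite F2 by lia; auto).
    assert (P2 : pts m2 sb l).
    { eapply pts_frame; [exact Hpts |]. intros y Hy. fold n in Hy. rewrite F2, Fr by lia; auto. }
    clear m' m1 Fr A B BS Bj Bz F2 Rn Rz Ri Rj Rpi Rpj RN RS Rjp Cn HJ.
    (* Shared by the two uses of [emit]: with [q = j] when [w] is reached, and with [q = n + 1] when
       even the full suffix stays below [w]. *)
    assert (Hemit : forall q m3, m3 rq = INR q -> (forall y, y <> 33%nat -> m3 y = m2 y) ->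
      first_end l w i q -> (i < j)%nat ->
      tri emit m3 24 (fun m' => exists v', Inv v' m' /\
        (v' + 40 + 2 <= 50 * (n - i + (n - j)) + 2)%nat)).
    { intros q m3 Hq F3 Hfe Hlt. unfold emit.
      assert (m3 rjp = INR (jp + i)) by (rewrite F3 by lia; auto).
      assert (m3 rone = 1) by (rewrite F3 by lia; auto).
      stk (jp + i)%nat. stp.
      destruct (pts_nth m2 sb l i (0, 0%nat) P2 ltac:(fold n; lia)) as [_ Hcol].
      set (c := snd (nth i l (0, 0%nat))) in *.
      assert (Hsl := slice_cons i j l (0, 0%nat) Hlt ltac:(fold n; lia)).
      assert (Hcc : ccount (slice i j l) c = S (ccount (slice (S i) j l) c))
        by (rewrite Hsl, ccount_cons; fold c; rewrite Nat.eqb_refl; auto).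
      eapply tri_seq with (T1 := 18%nat) (T2 := 1%nat);
        [apply bump_spec with (a := (sb + 2 * i)%nat) (c := c) (E := E) (k := ccount (slice i j l) c)
           (k' := ccount (slice (S i) j l) c) (N := (j - i)%nat) (N' := (j - S i)%nat) | | lia];
        rds; rewrite ?F3 by lia; auto; try lia.
      - rewrite Mm. rewrite Hcc, S_INR. ring.
      - rewrite Mm. inr.
      - intros m4 (A & B & C & D & F).
        assert (m4 ri = INR i) by (rewrite F by lia; rds; rewrite F3 by lia; auto).
        assert (m4 rone = 1) by (rewrite F by lia; rds; auto).
        stp. stp. apply tri_skip.
        exists (50 * ((n - S i) + (n - j)) + 2)%nat. split; [| lia].
        exists (S i), j.
        repeat match goal with |- _ /\ _ => split end; rds; auto; try lia; try inr.
        + rewrite F by lia. rds. rewrite F3 by lia; auto.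
        + rewrite A. f_equal; lia.
        + rewrite F by lia. rds. rewrite F3 by lia; auto.
        + rewrite B, MS, Hcc, Hsl. cbn [telescope]. fold c. ring.
        + rewrite F by lia. rds. inr.
        + intros c'. rds. destruct (Nat.eq_dec c' c) as [-> | Hne]; auto.
          rewrite F by lia. rds. rewrite F3 by lia. rewrite Cn2, Hsl, ccount_cons. fold c.
          destruct (Nat.eqb_spec c c'); [congruence | auto].
        + intros e He. eapply Rle_lt_trans; [apply scaled_entropy_slice_l; fold n; lia | auto].
        + intros t Ht. destruct (Nat.eq_dec t i) as [-> | Hne].
          * exists q. split; auto. rds. rewrite F by lia. rds. auto.
          * destruct (HJ2 t ltac:(lia)) as (J & HJ1 & HJ'). exists J. split; auto.
            rds. rewrite F by lia. rds. rewrite F3 by lia. auto.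
        + intros y Hy. rds. rewrite F by lia. rds. rewrite F3 by lia. apply Fr2; lia. }
    eapply tri_conseq with (T := 34%nat); [| lia | intros mm Hmm; exact Hmm].
    eapply tri_if; [rg | rg | |]; intro Hgw.
    + eapply tri_if; [rg | rg | |]; intro Hjn.
      * apply INR_lt in Hjn.
        destruct (pts_nth m2 sb l j (0, 0%nat) P2 ltac:(fold n; lia)) as [_ Hcol].
        set (c := snd (nth j l (0, 0%nat))) in *.
        assert (Hsl := slice_snoc i j l (0, 0%nat) ltac:(fold n; lia)).
        assert (Hcc : ccount (slice i (S j) l) c = S (ccount (slice i j l) c)).
        { rewrite Hsl, ccount_app, ccount_cons. fold c. rewrite Nat.eqb_refl. cbn; lia. }
        eapply tri_seq with (T1 := 18%nat) (T2 := 12%nat);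
          [apply bump_spec with (a := (sb + 2 * j)%nat) (c := c) (E := E) (k := ccount (slice i j l) c)
             (k' := ccount (slice i (S j) l) c) (N := (j - i)%nat) (N' := (S j - i)%nat) | | lia];
          auto; try lia.
        -- rewrite Mo, Hcc, S_INR. ring.
        -- rewrite Mo. inr.
        -- intros m4 (A & B & C & D & F).
           assert (m4 rj = INR j) by (rewrite F by lia; auto).
           assert (m4 rone = 1) by (rewrite F by lia; auto).
           stp. stp. apply tri_skip.
           exists (50 * ((n - i) + (n - S j)) + 2)%nat. split; [| lia].
           exists i, (S j).
           repeat match goal with |- _ /\ _ => split end; rds; auto; try lia; try inr.
           ++ rewrite F by lia. auto.
           ++ rewrite F by lia. auto.
           ++ rewrite A. f_equal; lia.
           ++ rewrite B, MS, Hcc, Hsl, telescope_snoc. fold c. ring.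
           ++ rewrite F by lia. auto.
           ++ intros c'. rds. destruct (Nat.eq_dec c' c) as [-> | Hne]; auto.
              rewrite F by lia. rewrite Cn2, Hsl, ccount_app, ccount_cons. fold c.
              destruct (Nat.eqb_spec c c'); [congruence | f_equal; cbn; lia].
           ++ intros e He. destruct (Nat.eq_dec e j) as [-> | ?]; auto. apply Lt; lia.
           ++ intros t Ht. destruct (HJ2 t ltac:(lia)) as (J & HJ1 & HJ'). exists J. split; auto.
              rds. rewrite F by lia. auto.
           ++ intros y Hy. rds. rewrite F by lia. apply Fr2; lia.
      * inr_in Hjn. assert (j = n) by lia. subst j.
        stp. eapply tri_conseq; [apply (Hemit (n + 1)%nat) | lia | intros mm Hmm; exact Hmm].
        -- rds. ring.
        -- intros y Hy. rds. auto.
        -- intros e He. fold n in He. split; [lia |]. intro Hge.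
           pose proof (scaled_entropy_slice_r i e n l ltac:(fold n; lia)). lra.
        -- lia.
    + eapply tri_conseq; [apply (Hemit j) | lia | intros mm Hmm; exact Hmm]; auto.
      * intros e He. fold n in He. split.
        -- intro Hje. pose proof (scaled_entropy_slice_r i j e l ltac:(fold n; lia)). lra.
        -- intro Hge. destruct (le_lt_dec j e); auto. pose proof (Lt e ltac:(lia)). lra.
      (* An empty window has value 0, below [w >= 1], so [i] cannot overtake [j]. *)
      * destruct (Nat.eq_dec i j) as [-> | ?]; [| lia].
        rewrite slice_nil, scaled_entropy_nil in Hgw by lia. lra.
  - intros v m' (i & j & -> & Hij & Ri & Rj & Rpi & Rpj & RN & RS & Rjp & Cn & Lt & HJ & Fr) Hc.
    rewrite Ri, Fr, Hn in Hc by lia. inr_in Hc. assert (i = n) by lia. assert (j = n) by lia. subst i j.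
    split; [lia |]. rewrite slice_nil in * by lia.
    repeat match goal with |- _ /\ _ => split end; auto.
    + rewrite RN, Nat.sub_diag; auto.
  - exists 0%nat, 0%nat.
    repeat match goal with |- _ /\ _ => split end; auto; try lia.
    + rewrite Hpi; f_equal; lia.
    + rewrite Hpj; f_equal; lia.
    + rewrite Hjp; f_equal; lia.
    + intros y Hy; auto.
Qed.

(** The counters start at [rE], behind the space reserved for all [L * n] entries, so no colour can
    reach an entry. The write address [rjp] arrives at [rE] exactly after [L] sweeps and thus
    doubles as the loop counter. *)
Definition tables : cmd :=
  Do (IAdd rjb ro rone) ;; Do (IMul rx rL rn) ;; Do (IAdd rE rjb rx) ;; Do (IAdd rjp rjb rzero) ;;
  Do (IConst rw 1) ;; Do (IConst rmone (-1)) ;; Do (IConst rtwo 2) ;; Do (IAdd rsb rh rone) ;;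
  Do (IAdd rn1 rn rone) ;; Do (IConst rN 0) ;; Do (IConst rS 0) ;;
  WhileLt rjp rE
    (Do (IConst ri 0) ;; Do (IConst rj 0) ;; Do (IAdd rpi rsb rzero) ;; Do (IAdd rpj rsb rzero) ;;
     sweep ;; Do (IMul rw rw re1)).

Lemma tables_spec m l eps b o L :
  let n := length l in
  (1 <= n)%nat -> 0 < eps ->
  m rzero = 0 -> m rone = 1 -> m rn = INR n -> m rh = INR b -> m ro = INR o -> m rL = INR L ->
  m re1 = 1 + eps -> pts m (b + 1) l -> (64 <= b)%nat -> (b + 1 + 2 * n <= o)%nat ->
  (forall y, (o < y)%nat -> m y = 0) ->
  tri tables m (100 * (L * n) + 20 * L + 15) (fun m' =>
    m' rE = INR (o + 1 + L * n) /\ m' rjb = INR (o + 1) /\ m' rsb = INR (b + 1) /\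
    (forall t i, (t < L)%nat -> (i < n)%nat ->
       exists J, m' (o + 1 + t * n + i)%nat = INR J /\ first_end l ((1 + eps) ^ t) i J) /\
    (forall y, (y < 8 \/ y = rL \/ y = rwt \/ 33 < y <= o)%nat -> m' y = m y)).
Proof.
  intros n Hn Heps Hz H1 Hrn Hh Ho HL He1 Hpts Bb Bo Hfree. unfold tables.
  replace (100 * (L * n) + 20 * L + 15)%nat with (11 + (100 * (L * n) + 20 * L + 4))%nat by lia.
  do 11 stp.
  remember (o + 1 + L * n)%nat as E eqn:HE.
  set (Inv := fun (v : nat) (m' : mem) => exists t,
    v = (100 * ((L - t) * n) + 20 * (L - t) + 2)%nat /\ (t <= L)%nat /\
    m' rjp = INR (o + 1 + t * n) /\ m' rw = (1 + eps) ^ t /\ m' re1 = 1 + eps /\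
    m' rzero = 0 /\ m' rone = 1 /\ m' rn = INR n /\ m' rtwo = 2 /\ m' rmone = -1 /\
    m' rn1 = INR (n + 1) /\ m' rE = INR E /\ m' rjb = INR (o + 1) /\ m' rsb = INR (b + 1) /\
    m' rN = 0 /\ m' rS = 0 /\ (forall c, m' (E + c)%nat = 0) /\
    (forall t' i, (t' < t)%nat -> (i < n)%nat ->
       exists J, m' (o + 1 + t' * n + i)%nat = INR J /\ first_end l ((1 + eps) ^ t') i J) /\
    (forall y, (y < 8 \/ y = rL \/ y = rwt \/ 33 < y <= o)%nat -> m' y = m y)).
  eapply tri_conseq;
    [apply tri_while with (Inv := Inv) (v := (100 * ((L - 0) * n) + 20 * (L - 0) + 2)%nat)
    | lia | intros m' H; exact H].
  - intros v m' (t & -> & Ht & Rjp & Rw & Re1 & Rz & R1 & Rn & R2 & Rm & Rn1 & RE & Rjb & Rsb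
                 & RN & RS & Cn & HJ & Fr) Hc.
    rewrite Rjp, RE in Hc. apply INR_lt in Hc.
    assert (Ht' : (t < L)%nat).
    { destruct (Nat.eq_dec t L) as [-> | ?]; [lia | lia]. }
    assert (HtL : (t * n + n <= L * n)%nat) by nia.
    exists (4 + (50 * (2 * n) + 4))%nat. do 4 stp.
    eapply tri_seq with (T1 := (50 * (2 * n) + 2)%nat) (T2 := 1%nat);
      [apply sweep_spec with (l := l) (w := (1 + eps) ^ t) (sb := (b + 1)%nat)
         (jp := (o + 1 + t * n)%nat) (E := E) | | lia];
      rds; auto; try lia; try inr.
    + eapply pts_frame; [exact Hpts |]. intros y Hy. rds. apply Fr. fold n in Hy; lia.
    + intro c. rds. auto.
    + apply pow_R1_Rle; lra.
    + fold n. intros m1 (MN & MS & Mjp & Mc & Mf & MJ).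
      assert (F1 : forall y, (y < 8 \/ 15 < y < 20 \/ y = 21 \/ 26 < y < 33 \/
                33 < y < o + 1 + t * n \/ o + 1 + t * n + n <= y < E)%nat -> m1 y = m' y)
        by (intros y Hy; rewrite Mf by lia; rds; auto).
      clear Mf.
      assert (m1 rw = (1 + eps) ^ t) by (rewrite F1 by lia; auto).
      assert (m1 re1 = 1 + eps) by (rewrite F1 by lia; auto).
      stp. stp. apply tri_skip.
      exists (100 * ((L - S t) * n) + 20 * (L - S t) + 2)%nat. split; [| nia].
      exists (S t).
      repeat match goal with |- _ /\ _ => split end; rds; try (rewrite F1 by lia); auto; try lia.
      * rewrite Mjp. f_equal; lia.
      * simpl; ring.
      * intro c. rds. apply Mc.
      * intros t' i Ht1 Hi. destruct (Nat.eq_dec t' t) as [-> | Hne].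
        -- destruct (MJ i Hi) as (J & HJ1 & HJ2). exists J. rds. auto.
        -- assert (t' * n + n <= t * n)%nat by nia.
           destruct (HJ t' i ltac:(lia) Hi) as (J & HJ1 & HJ2). exists J. rds.
           rewrite F1 by lia. auto.
      * intros y Hy. rds. rewrite F1 by lia. auto.
  - intros v m' (t & -> & Ht & Rjp & Rw & Re1 & Rz & R1 & Rn & R2 & Rm & Rn1 & RE & Rjb & Rsb
                 & RN & RS & Cn & HJ & Fr) Hc.
    rewrite Rjp, RE in Hc. inr_in Hc. split; [apply Nat.le_add_l |].
    assert (t = L) by nia. subst t. repeat split; auto.
  - exists 0%nat.
    repeat match goal with |- _ /\ _ => split end; rds; auto; try lia; try inr.
    + intro c. rds. apply Hfree; lia.
    + intros y Hy. rds. auto.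
Qed.

(** Cell 0 finally receives the end of the tables as the size, so the structure includes the
    registers and the dead runs left by sorting. *)
Definition build_cmd : cmd := init ;; merge_sort ;; powers ;; tables ;; Do (IAdd 0 rE rzero).

(** Everything a query relies on. Entry [(t, i)] lies at [jb + t * n + i]: one row per threshold,
    one column per left end. *)
Definition built (P : list cpoint) (eps : R) (L : nat) (E : nat) (m : mem) : Prop :=
  let n := length P in
  exists l sb wt jb,
    StronglySorted ple l /\ Permutation l P /\ (64 <= sb)%nat /\
    (sb + 2 * n <= wt)%nat /\ (wt + L < jb)%nat /\ E = (jb + L * n)%nat /\
    m rzero = 0 /\ m rone = 1 /\ m rn = INR n /\ m rL = INR L /\ m rwt = INR wt /\
    m rjb = INR jb /\ m rsb = INR sb /\ pts m sb l /\
    m wt = 0 /\ (forall t, (1 <= t <= L)%nat -> m (wt + t)%nat = (1 + eps) ^ t) /\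
    (forall t i, (t < L)%nat -> (i < n)%nat ->
       exists J, m (jb + t * n + i)%nat = INR J /\ first_end l ((1 + eps) ^ t) i J).

Lemma build_cmd_spec P eps Lmax :
  let n := length P in
  (1 <= n)%nat -> 0 < eps -> 2 * INR n * INR n <= (1 + eps) ^ Lmax ->
  tri build_cmd (build_input P eps)
    (20 * (n * Nat.log2 (2 * n)) + 60 * n + 100 * (Lmax * n) + 26 * Lmax + 200)
    (fun m => exists L E, (L <= Lmax)%nat /\ 2 * INR n * INR n <= (1 + eps) ^ L /\
       (E <= 140 * n + 2 * (n * Nat.log2 (2 * n)) + Lmax + Lmax * n + 2)%nat /\
       m 0%nat = INR E /\ built P eps L E m).
Proof.
  intros n Hn Heps HT. unfold build_cmd.
  eapply tri_seq with (T1 := (20 * n + 160)%nat)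
    (T2 := (20 * (n * Nat.log2 (2 * n)) + 40 * n + 100 * (Lmax * n) + 26 * Lmax + 40)%nat);
    [apply init_spec; auto | | fold n; lia].
  fold n. intros m1 (Z1 & O1 & N1 & E1 & H1 & T1 & R1 & F1).
  eapply tri_seq with (T1 := (20 * (n * Nat.log2 (2 * n)) + 40 * n + 4)%nat)
    (T2 := (100 * (Lmax * n) + 26 * Lmax + 36)%nat);
    [eapply merge_sort_spec with (a := (128 * n)%nat) (P := P); eauto; fold n; try lia | | lia].
  { intros; apply F1; lia. }
  fold n. intros m2 (b & l & Sl & Pl & Bb & Bb' & Z2 & O2 & N2 & E2 & H2 & T2 & P2 & F2).
  assert (Hl : length l = n) by (apply Permutation_length; auto).
  eapply tri_seq with (T1 := (6 * Lmax + 8)%nat)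
    (T2 := (100 * (Lmax * n) + 20 * Lmax + 28)%nat);
    [apply powers_spec with (n := n) (eps := eps) (wt := (b + 1 + 2 * n)%nat); auto; try lia | | lia].
  { congruence. }
  intros m3 (L & HL & HTL & L3 & X3 & W3 & T3 & HW & F3).
  assert (HLn : (L * n <= Lmax * n)%nat) by nia.
  eapply tri_seq with (T1 := (100 * (L * n) + 20 * L + 15)%nat) (T2 := 1%nat);
    [pose proof (tables_spec m3 l eps b (b + 1 + 2 * n + L) L) as HS; cbv zeta in HS;
     rewrite Hl in HS; apply HS; auto; try lia; try (rewrite F3 by lia; auto) | | nia].
  { eapply pts_frame; [exact P2 |]. intros y Hy. apply F3; lia. }
  { intros y Hy. rewrite F3 by lia. apply F2; lia. }
  intros m4 (E4 & J4 & S4 & T4 & F4).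
  assert (m4 rzero = 0) by (rewrite F4, F3 by lia; auto).
  stp. stp. apply tri_skip.
  (* Behind the header cell [b] follow [2 n] cells of sorted points, the zero cell, the [L] powers
     and the [L * n] entries. *)
  exists L, (b + 1 + 2 * n + L + 1 + L * n)%nat.
  split; auto. split; auto. split; [lia |]. split; [rds; ring |].
  exists l, (b + 1)%nat, (b + 1 + 2 * n)%nat, (b + 1 + 2 * n + L + 1)%nat.
  fold n.
  repeat match goal with |- _ /\ _ => split end; rds; auto; try lia;
    try (rewrite F4 by lia; auto; rewrite F3 by lia; auto; fail).
  - eapply pts_frame; [exact P2 |]. intros y Hy. rds. rewrite F4, F3 by lia; auto.
  - intros t Ht. rds. rewrite F4 by lia. auto.
  - intros t i Ht Hi. destruct (T4 t i Ht Hi) as (J & HJ1 & HJ2). exists J. rds. auto.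
Qed.

(** * Queries *)

Notation qbase := 40%nat (only parsing).
Notation qstride := 41%nat (only parsing).
Notation qlen := 42%nat (only parsing).
Notation qkey := 43%nat (only parsing).
Notation qzero := 50%nat (only parsing).
Notation qone := 51%nat (only parsing).
Notation qhalf := 52%nat (only parsing).
Notation qstep := 53%nat (only parsing).
Notation qpos := 54%nat (only parsing).
Notation qtry := 55%nat (only parsing).
Notation qaddr := 56%nat (only parsing).

(* The machine has no floor, so the position is found bit by bit: halving a power of two is exact,
   and the step leaves the integers only at its final value 1/2. *)
Definition bsearch (strict : bool) : cmd :=
  Do (IConst qone 1) ;; Do (IAdd qstep qone qone) ;; Do (IDiv qhalf qone qstep) ;;
  Do (IConst qstep 1) ;; Do (IConst qpos 0) ;;
  WhileLt qstep qlen (Do (IAdd qstep qstep qstep)) ;;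
  WhileLt qhalf qstep
    (Do (IAdd qtry qpos qstep) ;;
     IfLt qlen qtry Skip
       (Do (ISub qaddr qtry qone) ;; Do (IMul qaddr qaddr qstride) ;;
        Do (IAdd qaddr qbase qaddr) ;; Do (ILoad qaddr qaddr) ;;
        (if strict then IfLt qaddr qkey (Do (IAdd qpos qtry qzero)) Skip
         else IfLt qkey qaddr Skip (Do (IAdd qpos qtry qzero)))) ;;
     Do (IMul qstep qstep qhalf)).

Lemma INR_pow2 k : INR (2 ^ k) = 2 ^ k.
Proof. apply pow_INR. Qed.

(** [cnt] is kept in [[pos, pos + 2^k)] with step [2^k / 2]. The item at index [pos + step - 1]
    satisfies the test exactly when [cnt >= pos + step], and then [pos] advances. *)
Lemma bsearch_spec (strict : bool) (m : mem) base stride len cnt :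
  m qzero = 0 -> m qbase = INR base -> m qstride = INR stride -> m qlen = INR len ->
  (64 <= base)%nat -> (cnt <= len)%nat ->
  (forall t, (t < len)%nat ->
     (if strict then m (base + t * stride)%nat < m qkey
      else m (base + t * stride)%nat <= m qkey) <-> (t < cnt)%nat) ->
  tri (bsearch strict) m (25 * Nat.log2 len + 70) (fun m' =>
    m' qpos = INR cnt /\ forall y, (y < 50 \/ 56 < y \/ y = 50)%nat -> m' y = m y).
Proof.
  intros Hz Hb Hs Hl Bb Hcnt HP. unfold bsearch.
  set (K := S (Nat.log2 len)).
  assert (HK : (len <= 2 ^ K)%nat).
  { destruct (Nat.eq_dec len 0) as [-> | H]; [lia |].
    pose proof (Nat.log2_spec len ltac:(lia)). fold K in H0. lia. }
  replace (25 * Nat.log2 len + 70)%nat with (5 + (25 * K + 40))%nat by (unfold K; lia).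
  stp. stp. eapply tri_div; [rg | rg | lra |]. stp. stp.
  set (Inv1 := fun (v : nat) (m' : mem) => exists k, v = (3 * (K - k) + 2)%nat /\ (k <= K)%nat /\
    m' qstep = INR (2 ^ k) /\ m' qhalf = / 2 /\ m' qone = 1 /\ m' qpos = 0 /\
    forall y, (y < 50 \/ 56 < y \/ y = 50)%nat -> m' y = m y).
  eapply tri_seq with (T1 := (3 * (K - 0) + 2)%nat) (T2 := (22 * K + 38)%nat)
    (R := fun m' => exists k, (k <= K)%nat /\ (len <= 2 ^ k)%nat /\
      m' qstep = INR (2 ^ k) /\ m' qhalf = / 2 /\ m' qone = 1 /\ m' qpos = 0 /\
      forall y, (y < 50 \/ 56 < y \/ y = 50)%nat -> m' y = m y); [| | lia].
  { apply tri_while with (Inv := Inv1).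
    - intros v m' (k & -> & Hk & Rs & Rh & R1 & Rp & Fr) Hc.
      rewrite Rs, Fr, Hl in Hc by lia. apply INR_lt in Hc.
      assert (k < K)%nat by (destruct (Nat.eq_dec k K) as [-> | ?]; lia).
      exists 1%nat. stp. stp. apply tri_skip. exists (3 * (K - S k) + 2)%nat. split; [| lia].
      exists (S k). repeat match goal with |- _ /\ _ => split end; rds; auto; try lia.
      + rewrite <- plus_INR. f_equal. simpl; lia.
      + intros y Hy. rds. auto.
    - intros v m' (k & -> & Hk & Rs & Rh & R1 & Rp & Fr) Hc.
      rewrite Rs, Fr, Hl in Hc by lia. apply Rnot_lt_le, INR_le in Hc. split; [lia |].
      exists k. auto 10.
    - exists 0%nat. repeat match goal with |- _ /\ _ => split end; rds; auto; try lia; try lra.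
      + intros y Hy. rds. auto. }
  intros m1 (k0 & Hk0 & Hlen & S1 & H1 & O1 & P1 & F1).
  set (Inv := fun (v : nat) (m' : mem) => exists k pos, v = (20 * k + 2)%nat /\
    m' qstep = 2 ^ k / 2 /\ m' qhalf = / 2 /\ m' qone = 1 /\ m' qpos = INR pos /\
    (pos <= cnt < pos + 2 ^ k)%nat /\
    forall y, (y < 50 \/ 56 < y \/ y = 50)%nat -> m' y = m y).
  eapply tri_conseq;
    [apply tri_while with (Inv := Inv) (v := (20 * S k0 + 2)%nat)
    | unfold K in *; lia | intros m' H; exact H].
  - intros v m' (k & pos & -> & Rs & Rh & R1 & Rp & Hpos & Fr) Hc.
    (* For [k = 0] the step is 1/2, which the loop test rejects; otherwise it is an integer and may
       enter an address. *)
    rewrite Rs, Rh in Hc. destruct k as [|k]; [simpl in Hc; lra |].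
    assert (Rs' : m' qstep = INR (2 ^ k)) by (rewrite Rs, INR_pow2; simpl; field).
    clear Rs Hc.
    assert (m' qlen = INR len) by (rewrite Fr by lia; auto).
    assert (m' qzero = 0) by (rewrite Fr by lia; auto).
    assert (Hpow : (1 <= 2 ^ k)%nat) by (pose proof (Nat.pow_nonzero 2 k); lia).
    exists 18%nat. stp.
    eapply tri_seq with (T1 := 14%nat) (T2 := 1%nat) (R := fun m2 =>
      m2 qpos = INR (if le_lt_dec (pos + 2 ^ k) cnt then pos + 2 ^ k else pos) /\
      forall y, (y < 54 \/ 56 < y)%nat -> m2 y = m' y); [| | lia].
    + eapply tri_if; [rg | rg | |]; intro Hc.
      * rewrite <- plus_INR in Hc. apply INR_lt in Hc. apply tri_skip.
        destruct (le_lt_dec (pos + 2 ^ k) cnt); [lia |]. split; [rds; auto |]. intros; rds; auto.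
      * rewrite <- plus_INR in Hc. apply Rnot_lt_le, INR_le in Hc.
        assert (HPt := HP (pos + 2 ^ k - 1)%nat ltac:(lia)).
        assert (Hkey : m' qkey = m qkey) by (apply Fr; lia).
        assert (m' qstride = INR stride) by (rewrite Fr by lia; auto).
        assert (m' qbase = INR base) by (rewrite Fr by lia; auto).
        stp. eapply tri_mul; [rg | rg |]. stp.
        remember (pos + 2 ^ k - 1)%nat as t eqn:Et.
        remember (t * stride)%nat as ts eqn:Ets.
        assert (Hel : m' (base + ts)%nat = m (base + ts)%nat) by (apply Fr; lia).
        eapply (tri_load (base + ts)%nat); [rg | | rds; exact Hel |].
        { rewrite Ets. rewrite plus_INR, mult_INR, Et, minus_INR, plus_INR by lia. simpl (INR 1). ring. }
        destruct strict.
        -- eapply tri_if; [rg | rds; exact Hkey | |]; intro Hlt.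
           ++ stp. stp. apply tri_skip. apply HPt in Hlt.
              destruct (le_lt_dec (pos + 2 ^ k) cnt); [| lia].
              split; [rds; rewrite plus_INR; ring |]. intros; rds; auto.
           ++ apply tri_skip. rewrite HPt in Hlt.
              destruct (le_lt_dec (pos + 2 ^ k) cnt); [lia |].
              split; [rds; auto |]. intros; rds; auto.
        -- eapply tri_if; [rds; exact Hkey | rg | |]; intro Hlt.
           ++ apply tri_skip. apply Rlt_not_le in Hlt. rewrite HPt in Hlt.
              destruct (le_lt_dec (pos + 2 ^ k) cnt); [lia |].
              split; [rds; auto |]. intros; rds; auto.
           ++ stp. stp. apply tri_skip. apply Rnot_lt_le, HPt in Hlt.
              destruct (le_lt_dec (pos + 2 ^ k) cnt); [| lia].
              split; [rds; rewrite plus_INR; ring |]. intros; rds; auto.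
    + intros m2 [A B].
      assert (m2 qstep = INR (2 ^ k)) by (rewrite B by lia; auto).
      assert (m2 qhalf = / 2) by (rewrite B by lia; auto).
      stp. eapply tri_mul; [rg | rg |]. apply tri_skip.
      exists (20 * k + 2)%nat. split; [| lia].
      exists k, (if le_lt_dec (pos + 2 ^ k) cnt then pos + 2 ^ k else pos)%nat.
      repeat match goal with |- _ /\ _ => split end; rds; auto.
      * rewrite INR_pow2. reflexivity.
      * rewrite B by lia; auto.
      * destruct (le_lt_dec (pos + 2 ^ k) cnt); lia.
      * destruct (le_lt_dec (pos + 2 ^ k) cnt); simpl in Hpos; lia.
      * intros y Hy. rds. rewrite B by lia. auto.
  - intros v m' (k & pos & -> & Rs & Rh & R1 & Rp & Hpos & Fr) Hc.
    rewrite Rs, Rh in Hc. split; [lia |]. split; auto. rewrite Rp. f_equal.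
    destruct k as [|k]; [simpl in Hpos; lia |].
    exfalso. apply Hc. simpl. pose proof (pow_R1_Rle 2 k ltac:(lra)). lra.
  (* [cnt] may equal [len], and [len] may equal [2^k0], so the half-open range needs the exponent
     [k0 + 1]. *)
  - exists (S k0), 0%nat.
    repeat match goal with |- _ /\ _ => split end; auto; try lia.
    + rewrite S1, INR_pow2. simpl. field.
    + simpl. pose proof (Nat.pow_nonzero 2 k0); lia.
Qed.

(* Every cell [x >= 1] of the construction is cell [x + 1] of a query. *)
Definition query_cmd : cmd :=
  Do (IConst qzero 0) ;; Do (IConst 46 1) ;; Do (IConst 47 2) ;;
  Do (IAdd qbase (S rsb) 46) ;; Do (IAdd qstride 47 qzero) ;; Do (IAdd qlen (S rn) qzero) ;;
  Do (IAdd qkey 0 qzero) ;; bsearch true ;; Do (IAdd 44 qpos qzero) ;;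
  Do (IAdd qkey 1 qzero) ;; bsearch false ;; Do (IAdd 45 qpos qzero) ;;
  IfLt 44 45
    (Do (ISub 48 45 44) ;; Do (IAdd qbase (S rjb) 46) ;; Do (IAdd qbase qbase 44) ;;
     Do (IAdd qstride (S rn) qzero) ;; Do (IAdd qlen (S rL) qzero) ;; Do (IAdd qkey 45 qzero) ;;
     bsearch false ;;
     Do (IAdd 49 (S rwt) 46) ;; Do (IAdd 49 49 qpos) ;; Do (ILoad 49 49) ;; Do (IDiv 0 49 48))
    (Do (IConst 0 0)).

(** Supplies the [cnt] that [bsearch_spec] expects. The predicates compare reals, so the case split
    is classical. *)
Lemma prefix_count (P : nat -> Prop) len :
  (forall s t, (s <= t < len)%nat -> P t -> P s) ->
  exists cnt, (cnt <= len)%nat /\ forall t, (t < len)%nat -> P t <-> (t < cnt)%nat.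
Proof.
  induction len as [|len IH]; intro H.
  - exists 0%nat. split; auto. intros; lia.
  - destruct (classic (P len)) as [HP | HP].
    + exists (S len). split; auto. intros t Ht. split; [lia |]. intros _. apply (H t len); auto; lia.
    + destruct IH as (cnt & Hc & Hcnt); [intros s t Hst; apply H; lia |].
      exists cnt. split; [lia |]. intros t Ht.
      destruct (Nat.eq_dec t len) as [-> | Hne]; [| apply Hcnt; lia].
      split; [tauto | lia].
Qed.

Lemma StronglySorted_nth (l : list cpoint) d s t :
  StronglySorted ple l -> (s <= t < length l)%nat -> fst (nth s l d) <= fst (nth t l d).
Proof.
  intro Hs. revert s t. induction Hs as [|x l Hs IH Hx]; intros s t Hst; simpl in Hst; [lia |].
  destruct s as [|s], t as [|t]; simpl; try lra; try lia.
  - rewrite Forall_forall in Hx. apply Hx, nth_In; lia.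
  - apply IH; lia.
Qed.

(** The strict test on the left and the weak one on the right make both endpoints of the query
    interval count. [e <= i] means an empty window. *)
Lemma inter_slice (P l : list cpoint) a b i e :
  Permutation l P ->
  (forall t, (t < length l)%nat -> fst (nth t l (0, 0%nat)) < a <-> (t < i)%nat) ->
  (forall t, (t < length l)%nat -> fst (nth t l (0, 0%nat)) <= b <-> (t < e)%nat) ->
  Permutation (inter P a b) (slice i e l).
Proof.
  intros HP Hi He. unfold inter.
  rewrite <- (filter_slice (A := cpoint) (fun p => if Rle_dec a (fst p) then if Rle_dec (fst p) b
    then true else false else false) (0, 0%nat) l i e).
  - apply Permutation_filter'. apply Permutation_sym; auto.
  - intros t Ht. specialize (Hi t Ht). specialize (He t Ht).
    destruct (Rle_dec a (fst (nth t l (0, 0%nat)))) as [Ha | Ha];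
      [destruct (Rle_dec (fst (nth t l (0, 0%nat))) b) as [Hb | Hb] |];
      (split; [intro; try discriminate | intro Hie; auto; exfalso]).
    + split; [| tauto]. destruct (le_lt_dec i t); auto. exfalso. apply Hi in l0. lra.
    + apply Hb, He; lia.
    + assert (t < i)%nat by (apply Hi; lra). lia.
Qed.

Lemma entropy_perm Q Q' : Permutation Q Q' -> entropy Q = entropy Q'.
Proof.
  intro H. destruct (Nat.eq_dec (length Q) 0) as [Hz | Hz].
  - destruct Q; [| simpl in Hz; lia]. apply Permutation_nil in H. subst; auto.
  - assert (Hl := Permutation_length H).
    rewrite !entropy_scaled by lia. rewrite Hl, (scaled_entropy_perm _ _ H); auto.
Qed.

(** An entry is at most [e] exactly when its threshold is at most [G], so the third search counts
    the thresholds reached, [cnt]. If [cnt > 0], then [G] lies between the powers [cnt - 1] and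
    [cnt] of [1 + eps], and the upper one is returned, divided by the window size. *)
Lemma query_cmd_spec P eps L E mb a b :
  let n := length P in
  (1 <= n)%nat -> 0 < eps -> 2 * INR n * INR n <= (1 + eps) ^ L -> built P eps L E mb ->
  tri query_cmd (query_input (structure_of mb E) a b)
    (50 * Nat.log2 n + 25 * Nat.log2 L + 260)
    (fun m => entropy (inter P a b) <= m 0%nat <= (1 + eps) * entropy (inter P a b)).
Proof.
  intros n Hn Heps HT HB.
  unfold built in HB. cbv zeta in HB. fold n in HB.
  destruct HB as (l & sb & wt & jb & Sl & Pl & Bsb & Bwt & Bjb & -> & Bz & B1 & Bn & BL & Bw & Bj
                  & Bs & Pts & W0 & HW & HJ).
  assert (Hlen : length l = n) by (apply Permutation_length; auto).
  set (m0 := query_input (structure_of mb (jb + L * n)) a b).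
  assert (M0 : forall x, (1 <= x <= jb + L * n)%nat -> m0 (S x) = mb x).
  { intros [|x] Hx; [lia |]. unfold m0, query_input, structure_of.
    rewrite (nth_indep _ 0 ((fun i => mb (S i)) 0%nat)) by (rewrite length_map, length_seq; lia).
    rewrite (map_nth (fun i => mb (S i))), seq_nth by lia. reflexivity. }
  assert (Ma : m0 0%nat = a) by reflexivity. assert (Mb : m0 1%nat = b) by reflexivity.
  clearbody m0.
  assert (Q5 : m0 5%nat = INR n) by (rewrite M0 by lia; auto).
  assert (Q17 : m0 17%nat = INR L) by (rewrite M0 by lia; auto).
  assert (Q30 : m0 30%nat = INR wt) by (rewrite M0 by lia; auto).
  assert (Q31 : m0 31%nat = INR jb) by (rewrite M0 by lia; auto).
  assert (Q32 : m0 32%nat = INR sb) by (rewrite M0 by lia; auto).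
  assert (Qp : forall t, (t < n)%nat -> m0 (sb + 1 + t * 2)%nat = fst (nth t l (0, 0%nat))).
  { intros t Ht. destruct (pts_nth mb sb l t (0, 0%nat) Pts ltac:(lia)) as [<- _].
    replace (sb + 1 + t * 2)%nat with (S (sb + 2 * t)) by lia. apply M0; lia. }
  destruct (prefix_count (fun t => fst (nth t l (0, 0%nat)) < a) n) as (i & Hi & Hic).
  { intros s t Hst Ht. pose proof (StronglySorted_nth l (0, 0%nat) s t Sl ltac:(lia)). lra. }
  destruct (prefix_count (fun t => fst (nth t l (0, 0%nat)) <= b) n) as (e & He & Hec).
  { intros s t Hst Ht. pose proof (StronglySorted_nth l (0, 0%nat) s t Sl ltac:(lia)). lra. }
  assert (HI : Permutation (inter P a b) (slice i e l))
    by (apply inter_slice; rewrite ?Hlen; auto).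
  rewrite (entropy_perm _ _ HI). clear HI.
  unfold query_cmd.
  replace (50 * Nat.log2 n + 25 * Nat.log2 L + 260)%nat
    with (7 + (50 * Nat.log2 n + 25 * Nat.log2 L + 253))%nat by lia.
  do 7 stp.
  eapply tri_seq with (T1 := (25 * Nat.log2 n + 70)%nat)
    (T2 := (2 + (25 * Nat.log2 n + 25 * Nat.log2 L + 181))%nat);
    [apply bsearch_spec with (base := (sb + 1)%nat) (stride := 2%nat) (cnt := i)
    | | lia]; rds; auto; try lia; try inr.
  { intros t Ht. rds. rewrite Qp, Rplus_0_r by auto. auto. }
  intros m1 [P1 F1].
  assert (A1 : forall y, (y < 40)%nat -> m1 y = m0 y) by (intros; rewrite F1 by lia; rds; auto).
  assert (Z1 : m1 qzero = 0) by (rewrite F1 by lia; rds; auto).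
  assert (O1 : m1 46%nat = 1) by (rewrite F1 by lia; rds; auto).
  assert (S1 : m1 qstride = INR 2) by (rewrite F1 by lia; rds; inr).
  assert (L1 : m1 qlen = INR n) by (rewrite F1 by lia; rds; ring).
  assert (D1 : m1 qbase = INR (sb + 1)) by (rewrite F1 by lia; rds; inr).
  assert (G1 : forall y, (64 <= y)%nat -> m1 y = m0 y) by (intros; rewrite F1 by lia; rds; auto).
  assert (Mb1 : m1 1%nat = b) by (rewrite A1 by lia; auto).
  stp. stp.
  eapply tri_seq with (T1 := (25 * Nat.log2 n + 70)%nat)
    (T2 := (1 + (25 * Nat.log2 L + 110))%nat);
    [apply bsearch_spec with (base := (sb + 1)%nat) (stride := 2%nat) (cnt := e)
    | | lia]; rds; auto; try lia.
  { intros t Ht. rds. rewrite G1, Qp, Rplus_0_r by (auto; lia). auto. }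
  intros m2 [P2 F2].
  assert (A2 : forall y, (y < 40)%nat -> m2 y = m0 y)
    by (intros; rewrite F2 by lia; rds; apply A1; lia).
  assert (Z2 : m2 qzero = 0) by (rewrite F2 by lia; rds; auto).
  assert (O2 : m2 46%nat = 1) by (rewrite F2 by lia; rds; auto).
  assert (I2 : m2 44%nat = INR i) by (rewrite F2 by lia; rds; ring).
  assert (G2 : forall y, (64 <= y)%nat -> m2 y = m0 y)
    by (intros; rewrite F2 by lia; rds; apply G1; lia).
  stp.
  assert (A2' : m2 5%nat = INR n) by (rewrite A2 by lia; auto).
  assert (m2 17%nat = INR L) by (rewrite A2 by lia; auto).
  assert (m2 30%nat = INR wt) by (rewrite A2 by lia; auto).
  assert (m2 31%nat = INR jb) by (rewrite A2 by lia; auto).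
  replace (INR e + 0) with (INR e) by ring.
  eapply tri_conseq with (T := S (S (6 + (25 * Nat.log2 L + 100)))); [| lia | intros mm Hm; exact Hm].
  eapply tri_if; [rg | rg | |]; intro Hie.
  - apply INR_lt in Hie.
    do 6 stp.
    (* Column [i] of the table is searched: consecutive thresholds are [n] cells apart, and the
       [+ 1] is the shift between construction and query memory. *)
    assert (HJ' : forall t, (t < L)%nat -> exists J,
      m0 (jb + 1 + i + t * n)%nat = INR J /\ first_end l ((1 + eps) ^ t) i J).
    { intros t Ht. destruct (HJ t i Ht ltac:(lia)) as (J & HJ1 & HJ2). exists J. split; auto.
      rewrite <- HJ1. replace (jb + 1 + i + t * n)%nat with (S (jb + t * n + i)) by lia.
      apply M0. nia. }
    set (g := scaled_entropy (slice i e l)) in *.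
    destruct (prefix_count (fun t => (1 + eps) ^ t <= g) L) as (cnt & Hcnt & Hc).
    { intros s t Hst Ht. eapply Rle_trans; [apply Rle_pow; [lra | apply Hst] | auto]. }
    eapply tri_seq with (T1 := (25 * Nat.log2 L + 70)%nat) (T2 := 4%nat);
      [apply bsearch_spec with (base := (jb + 1 + i)%nat) (stride := n) (cnt := cnt)
         (len := L) | | lia]; rds; auto; try lia; try inr.
    { intros t Ht. rewrite <- Hc by auto. destruct (HJ' t Ht) as (J & HJ1 & HJ2).
      remember (t * n)%nat as tn. rds. rewrite G2 by lia. rewrite HJ1, Rplus_0_r.
      apply iff_trans with (J <= e)%nat; [split; [apply INR_le | apply le_INR] | apply HJ2; lia]. }
    intros m3 [P3 F3].
    assert (m3 30%nat = INR wt) by (rewrite F3 by lia; rds; auto).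
    assert (m3 46%nat = 1) by (rewrite F3 by lia; rds; auto).
    assert (N3 : m3 48%nat = INR (e - i)) by (rewrite F3 by lia; rds; inr).
    (* Threshold 1 must be in the table, so that [cnt = 0] implies [G < 1]; it is, since
       [2 n^2 > 1]. *)
    assert (HL1 : (1 <= L)%nat).
    { destruct L; [| lia]. simpl in HT. pose proof (le_INR 1 n Hn) as HnR. simpl in HnR. nra. }
    (* If all thresholds are reached, the cap [2 n^2] bounds [G]; otherwise threshold [cnt] was not
       reached. *)
    assert (Hg : g <= (1 + eps) ^ cnt).
    { destruct (Nat.eq_dec cnt L) as [-> | Hne].
      - eapply Rle_trans; [| exact HT]. apply scaled_entropy_le. rewrite length_slice; lia.
      - destruct (Rle_lt_dec ((1 + eps) ^ cnt) g) as [Hle | ?]; [| lra].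
        apply Hc in Hle; lia. }
    assert (HN : 0 < INR (e - i)) by (apply lt_0_INR; lia).
    (* For [cnt = 0] the cell read is the zero cell, and the gap turns [G < 1] into [G = 0]. *)
    assert (V : exists v, mb (wt + cnt)%nat = v /\ g <= v <= (1 + eps) * g).
    { eexists; split; [reflexivity |]. destruct cnt as [|cnt].
      - rewrite Nat.add_0_r, W0.
        assert (~ 1 <= g) by (intro Hg1; assert (0 < 0)%nat by (apply Hc; [lia | exact Hg1]); lia).
        destruct (scaled_entropy_gap (slice i e l)) as [Hz | Hz]; fold g in Hz; [| lra].
        rewrite Hz; lra.
      - rewrite HW by lia. split; auto.
        assert (Hg2 : (1 + eps) ^ cnt <= g) by (apply Hc; lia).
        simpl. apply Rmult_le_compat_l; lra. }
    destruct V as (v & Hv & Hv1 & Hv2).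
    stp. stp. eapply (tri_load (wt + 1 + cnt)%nat); [rg | inr | |].
    { rds. rewrite F3 by lia. rds. rewrite G2 by lia.
      replace (wt + 1 + cnt)%nat with (S (wt + cnt)) by lia. rewrite M0 by lia. exact Hv. }
    stp. eapply tri_div; [rg | rg | lra |]. apply tri_skip. rds.
    rewrite entropy_scaled by (rewrite length_slice; lia). rewrite length_slice by lia. fold g.
    split.
    + unfold Rdiv. apply Rmult_le_compat_r; auto. left; apply Rinv_0_lt_compat; auto.
    + unfold Rdiv. rewrite <- Rmult_assoc. apply Rmult_le_compat_r; auto.
      left; apply Rinv_0_lt_compat; auto.
  - apply Rnot_lt_le, INR_le in Hie. rewrite slice_nil by lia.
    stp. stp. apply tri_skip. rds. unfold entropy; simpl. lra.
Qed.

(** * The bounds *)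

Lemma Nat_log2_le_log2 k : (1 <= k)%nat -> INR (Nat.log2 k) <= log2 (INR k).
Proof.
  intro Hk. pose proof (Nat.log2_spec k ltac:(lia)) as [H _].
  apply le_INR in H. rewrite pow_INR in H. change (INR 2) with 2 in H.
  replace (INR (Nat.log2 k)) with (log2 (2 ^ Nat.log2 k)).
  - apply log2_le; auto. apply pow_lt; lra.
  - rewrite log2_pow, log2_2 by lra. ring.
Qed.

(** The exponent must satisfy [K log2 (1 + eps) >= 1 + 2 log2 n]. The right side is at most
    [3 log2 n], and [log2 (1 + eps) >= eps / (1 + eps) >= eps / 2], so [6 log2 n / eps] suffices;
    rounding up costs at most one more [log2 n / eps], which gives 7. *)
Lemma exists_levels n eps : (2 <= n)%nat -> 0 < eps < 1 ->
  exists K, (1 <= K)%nat /\ INR K <= 7 * (log2 (INR n) / eps) /\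
    2 * INR n * INR n <= (1 + eps) ^ K.
Proof.
  intros Hn Heps. set (ell := log2 (INR n)).
  assert (HnR : 2 <= INR n) by (apply (le_INR 2); auto).
  assert (Hell : 1 <= ell) by (rewrite <- log2_2; apply log2_le; lra).
  assert (Hx : 1 <= ell / eps).
  { apply Rmult_le_reg_r with eps; [lra |]. unfold Rdiv. rewrite Rmult_assoc, Rinv_l by lra. lra. }
  destruct (archimed (6 * (ell / eps))) as [U1 U2].
  set (K := Z.to_nat (up (6 * (ell / eps)))).
  assert (HK : INR K = IZR (up (6 * (ell / eps)))).
  { unfold K. rewrite INR_IZR_INZ, Z2Nat.id; auto. apply le_IZR. lra. }
  exists K. split; [apply INR_le; simpl; lra |]. split; [lra |].
  destruct (Rle_lt_dec (2 * INR n * INR n) ((1 + eps) ^ K)) as [| Hlt]; auto. exfalso.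
  assert (H1 : log2 ((1 + eps) ^ K) <= log2 (2 * INR n * INR n))
    by (apply log2_le; [apply pow_lt | ]; lra).
  rewrite log2_pow, !log2_mult, log2_2 in H1 by lra. fold ell in H1.
  assert (H2 : eps / 2 <= log2 (1 + eps)).
  { pose proof (ln_ge_1_inv (1 + eps) ltac:(lra)) as H.
    assert (H3 : eps / 2 <= 1 - / (1 + eps)).
    { replace (1 - / (1 + eps)) with (eps * / (1 + eps)) by (field; lra).
      apply Rmult_le_compat_l; [lra |]. apply Rinv_le_contravar; lra. }
    unfold log2. pose proof ln2_bounds. apply Rmult_le_reg_r with (ln 2); [lra |].
    unfold Rdiv at 2. rewrite Rmult_assoc, Rinv_l by lra. nra. }
  assert (H3 : 6 * ell < INR K * eps).
  { apply Rmult_lt_reg_r with (/ eps); [apply Rinv_0_lt_compat; lra |].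
    rewrite (Rmult_assoc (INR K)), Rinv_r by lra. unfold Rdiv in *. lra. }
  pose proof (pos_INR K). nra.
Qed.

Theorem theorem5p11 :
  exists (build query : list instr) (C : R), 0 < C /\
  forall (P : list cpoint) (eps : R),
    (2 <= length P)%nat ->
    NoDup (map fst P) ->
    0 < eps < 1 ->
    let n := INR (length P) in
    exists (tb s : nat) (mb : mem),
      runs build (build_input P eps) tb mb /\
      mb 0%nat = INR s /\
      INR tb <= C * (1 + n / eps * log2 n ^ 5) /\
      INR s <= C * (1 + n / eps * log2 n ^ 2) /\
      forall a b : R,
        exists (tq : nat) (mq : mem),
          runs query (query_input (structure_of mb s) a b) tq mq /\
          INR tq <= C * (1 + log2 n ^ 2 * log2 (log2 n / eps)) /\
          entropy (inter P a b) <= mq 0%nat <=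
            (1 + eps) * entropy (inter P a b) + eps.
Proof.
  (* In units of [n / eps * log2 n] the construction takes at most 40 + 60 + 700 + 182 steps, plus
     200; this is the largest of the three demands, and 2000 leaves room. *)
  exists (compile 0 build_cmd ++ [IHalt]), (compile 0 query_cmd ++ [IHalt]), 2000.
  split; [lra |]. intros P eps HP _ Heps n.
  destruct (exists_levels (length P) eps HP Heps) as (K & HK1 & HK & HT). fold n in HK, HT.
  destruct (tri_runs _ _ _ _ (build_cmd_spec P eps K ltac:(lia) ltac:(apply Heps) HT))
    as (tb & mb & Hrun & Htb & L & E & HL & HTL & HE & H0 & HB).
  exists tb, E, mb. split; auto. split; auto.
  set (ell := log2 n) in *.
  assert (HnR : 2 <= n) by (apply (le_INR 2); auto).
  assert (Hell : 1 <= ell) by (rewrite <- log2_2; apply log2_le; lra).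
  assert (Hx : ell <= ell / eps).
  { apply Rmult_le_reg_r with eps; [lra |]. unfold Rdiv. rewrite Rmult_assoc, Rinv_l by lra. nra. }
  assert (Hlog : INR (Nat.log2 (2 * length P)) <= 2 * ell).
  { rewrite Nat.log2_double, S_INR by lia.
    pose proof (Nat_log2_le_log2 (length P) ltac:(lia)). fold n ell in H. lra. }
  assert (Hu : n <= n / eps).
  { apply Rmult_le_reg_r with eps; [lra |]. unfold Rdiv. rewrite Rmult_assoc, Rinv_l by lra. nra. }
  assert (Hexu : ell / eps <= n / eps * ell).
  { replace (n / eps * ell) with (n * (ell / eps)) by (field; lra). nra. }
  assert (HKn : INR K * n <= 7 * (n / eps * ell)).
  { replace (n / eps * ell) with (ell / eps * n) by (field; lra).
    rewrite <- Rmult_assoc. apply Rmult_le_compat_r; lra. }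
  assert (Hnl : n * ell <= n / eps * ell) by (apply Rmult_le_compat_r; lra).
  assert (Hnlog : n * INR (Nat.log2 (2 * length P)) <= 2 * (n / eps * ell))
    by (pose proof (Rmult_le_compat_l n _ _ ltac:(lra) Hlog); lra).
  assert (Hn1 : n <= n / eps * ell) by nra.
  assert (Hpos : 0 <= n / eps * ell) by lra.
  assert (Hp1 : ell <= ell ^ 2) by (rewrite <- (pow_1 ell) at 1; apply Rle_pow; auto; lia).
  assert (Hp5 : ell <= ell ^ 5) by (rewrite <- (pow_1 ell) at 1; apply Rle_pow; auto; lia).
  split; [| split].
  - apply le_INR in Htb. rewrite !plus_INR, !mult_INR in Htb. fold n in Htb.
    assert (n / eps * ell <= n / eps * ell ^ 5) by (apply Rmult_le_compat_l; lra).
    replace (INR 20) with 20 in Htb by (simpl; ring). replace (INR 60) with 60 in Htb by (simpl; ring).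
    replace (INR 100) with 100 in Htb by (simpl; ring). replace (INR 26) with 26 in Htb by (simpl; ring).
    replace (INR 200) with 200 in Htb by (simpl; ring). lra.
  - apply le_INR in HE. rewrite !plus_INR, !mult_INR in HE. fold n in HE.
    assert (n / eps * ell <= n / eps * ell ^ 2) by (apply Rmult_le_compat_l; lra).
    replace (INR 140) with 140 in HE by (simpl; ring). replace (INR 2) with 2 in HE by (simpl; ring).
    lra.
  - intros a b.
    destruct (tri_runs _ _ _ _ (query_cmd_spec P eps L E mb a b ltac:(lia) ltac:(lra) HTL HB))
      as (tq & mq & Hrunq & Htq & Hans).
    exists tq, mq. split; auto. split.
    + apply le_INR in Htq. rewrite !plus_INR, !mult_INR in Htq.
      replace (INR 50) with 50 in Htq by (simpl; ring). replace (INR 25) with 25 in Htq by (simpl; ring).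
      replace (INR 260) with 260 in Htq by (simpl; ring).
      pose proof (Nat_log2_le_log2 (length P) ltac:(lia)) as Hn'. fold n ell in Hn'.
      (* 3 is [log2 8], absorbing the factor 7 of [exists_levels]. *)
      assert (HL' : INR (Nat.log2 L) <= 3 + log2 (ell / eps)).
      { eapply Rle_trans; [apply le_INR, (Nat.log2_le_mono L K); auto |].
        eapply Rle_trans; [apply Nat_log2_le_log2; auto |].
        replace 3 with (log2 (2 ^ 3)) by (rewrite log2_pow, log2_2 by lra; simpl; ring).
        rewrite <- log2_mult by lra. apply log2_le; [apply lt_0_INR; lia |]. lra. }
      assert (Hy : 0 <= log2 (ell / eps)) by (rewrite <- log2_1; apply log2_le; lra).
      assert (Hyl : log2 (ell / eps) <= ell ^ 2 * log2 (ell / eps)) by nra.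
      (* The factor [log2 (ell / eps)] can be close to 0, but only while [ell] is bounded: for
         [ell > 2] it is at least 1, and otherwise the constant 2 covers [ell]. *)
      assert (Hl : ell <= 2 + ell ^ 2 * log2 (ell / eps)).
      { destruct (Rle_lt_dec ell 2) as [| H2]; [nra |].
        assert (1 <= log2 (ell / eps)) by (rewrite <- log2_2; apply log2_le; lra). nra. }
      lra.
    + lra.
Qed.
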